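(* Let $(F,H)$ be a permissible pair of functions. Let $\mathcal C$ be a nonempty class of $(F,H)$-metrized quantum vector bundles and let $\mathcal T$ be a class of modular tunnels appropriate for $\mathcal C$. For $\mathbb A,\mathbb B\in\mathcal C$ set $$\mathsf\Lambda^{\ast\mathsf{mod}}_{\mathcal T}(\mathbb A,\mathbb B)=\inf\{\chi(\tau):\tau\in\mathcal T\text{ is a modular tunnel from }\mathbb A\text{ to }\mathbb B\}.$$ Then $\mathsf\Lambda^{\ast\mathsf{mod}}_{\mathcal T}$ is a metric on $\mathcal C$ up to full modular quantum isometry; that is, $\mathsf\Lambda^{\ast\mathsf{mod}}_{\mathcal T}$ is a pseudo-metric on $\mathcal C$, and for all $\mathbb A,\mathbb B\in\mathcal C$, $\mathsf\Lambda^{\ast\mathsf{mod}}_{\mathcal T}(\mathbb A,\mathbb B)=0$ if and only if there exists a full modular quantum isometry from $\mathbb A$ to $\mathbb B$.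
   Context: **Basics.** For a unital C*-algebra $\mathfrak A$: $\mathfrak{sa}(\mathfrak A)$ is the set of self-adjoint elements, $\mathscr S(\mathfrak A)$ the state space, $1_{\mathfrak A}$ the unit, $\Re a=\frac12(a+a^* )$, $\Im a=\frac1{2i}(a-a^* )$. $\|\cdot\|_E$ is the norm of a normed space $E$. Densely defined (semi)norms are given the value $\infty$ off their domain $\mathrm{dom}(\cdot)$. A function $F:[0,\infty)^4\to[0,\infty)$ is *permissible* if it is weakly increasing for the product order and $F(x,y,l_x,l_y)\ge x l_y+y l_x$. A pair $(F,H)$ is *permissible* if $F$ is permissible and $H:[0,\infty)^2\to[0,\infty)$ is weakly increasing for the product order with $H(x,y)\ge 2xy$. An *$F$-quasi-Leibniz quantum compact metric space* $(\mathfrak A,\mathsf L)$ is a unital C*-algebra $\mathfrak A$ with a seminorm $\mathsf L$ on a dense Jordan–Lie subalgebra $\mathrm{dom}(\mathsf L)$ of $\mathfrak{sa}(\mathfrak A)$ (a real subspace stable under $(a,b)\mapsto\Re(ab),\Im(ab)$) such that: (1) $\{a\in\mathrm{dom}(\mathsf L):\mathsf L(a)=0\}=\mathbb R1_{\mathfrak A}$; (2) $\mathsf{mk}_{\mathsf L}(\varphi,\psi)=\sup\{|\varphi(a)-\psi(a)|:\mathsf L(a)\le1\}$ metrizes the weak* topology of $\mathscr S(\mathfrak A)$; (3) $\mathsf L$ is lower semi-continuous for $\|\cdot\|_{\mathfrak A}$; (4) $\max\{\mathsf L(\Re(ab)),\mathsf L(\Im(ab))\}\le F(\|a\|_{\mathfrak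 A},\|b\|_{\mathfrak A},\mathsf L(a),\mathsf L(b))$ for $a,b\in\mathrm{dom}(\mathsf L)$. A *quantum isometry* $\pi:(\mathfrak A,\mathsf L_{\mathfrak A})\to(\mathfrak B,\mathsf L_{\mathfrak B})$ is a surjective unital *-morphism with $\mathsf L_{\mathfrak B}(b)=\inf\{\mathsf L_{\mathfrak A}(a):a\in\mathfrak{sa}(\mathfrak A),\pi(a)=b\}$ for all $b\in\mathfrak{sa}(\mathfrak B)$; a *full quantum isometry* is a *-isomorphism with $\mathsf L_{\mathfrak B}\circ\pi=\mathsf L_{\mathfrak A}$. A *Hilbert $\mathfrak A$-module* $(\mathscr M,\langle\cdot,\cdot\rangle_{\mathscr M})$ is a left $\mathfrak A$-module with a sesquilinear $\mathfrak A$-valued map satisfying $\langle a\omega,\eta\rangle=a\langle\omega,\eta\rangle$, $\langle\omega,\eta\rangle=\langle\eta,\omega\rangle^*$, $\langle\omega,\omega\rangle\ge0$ with equality to $0$ iff $\omega=0$, complete for $\|\omega\|_{\mathscr M}=\|\langle\omega,\omega\rangle_{\mathscr M}\|_{\mathfrak A}^{1/2}$. A *module morphism* $(\theta,\Theta)$ from a left $\mathfrak A$-module $\mathscr M$ to a left $\mathfrak B$-module $\mathscr N$ is a unital *-morphism $\theta:\mathfrak A\to\mathfrak B$ and a linear $\Theta:\mathscr M\to\mathscr N$ with $\Theta(a\omega)=\theta(a)\Theta(\omega)$; it is a *Hilbert module morphism* if moreover $\theta(\langle\omega,\eta\rangle_{\mathscr M})=\langle\Theta\omega,\Theta\eta\rangle_{\mathscr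 N}$, and an isomorphism if $\theta,\Theta$ are bijective. An *$(F,H)$-metrized quantum vector bundle* $(\mathscr M,\langle\cdot,\cdot\rangle_{\mathscr M},\mathsf D,\mathfrak A,\mathsf L)$ consists of an $F$-quasi-Leibniz quantum compact metric space $(\mathfrak A,\mathsf L)$ (its base quantum space), a Hilbert $\mathfrak A$-module $\mathscr M$, and a norm $\mathsf D$ on a dense $\mathbb C$-subspace $\mathrm{dom}(\mathsf D)$ of $\mathscr M$ (a D-norm) with: $\|\omega\|_{\mathscr M}\le\mathsf D(\omega)$; $\{\omega:\mathsf D(\omega)\le1\}$ is compact for $\|\cdot\|_{\mathscr M}$; and $\max\{\mathsf L(\Re\langle\omega,\eta\rangle_{\mathscr M}),\mathsf L(\Im\langle\omega,\eta\rangle_{\mathscr M})\}\le H(\mathsf D(\omega),\mathsf D(\eta))$ for $\omega,\eta\in\mathrm{dom}(\mathsf D)$. A *modular quantum isometry* from $(\mathscr M,\dots,\mathsf D_{\mathscr M},\mathfrak A,\mathsf L_{\mathfrak A})$ to $(\mathscr N,\dots,\mathsf D_{\mathscr N},\mathfrak B,\mathsf L_{\mathfrak B})$ is a Hilbert module morphism $(\theta,\Theta)$ with $\theta$ a quantum isometry, $\Theta$ surjective and $\mathsf D_{\mathscr N}(\omega)=\inf\{\mathsf D_{\mathscr M}(\eta):\Theta(\eta)=\omega\}$ for all $\omega\in\mathscr N$. A *full modular quantum isometry* is a Hilbert module isomorphism $(\theta,\Theta)$ with $\theta$ a full quantum isometry and $\mathsf D_{\mathscr N}\circ\Theta=\mathsf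 D_{\mathscr M}$. **Tunnels.** An *$F$-tunnel* $(\mathfrak D,\mathsf L_{\mathfrak D},\pi_1,\pi_2)$ from $(\mathfrak A_1,\mathsf L_1)$ to $(\mathfrak A_2,\mathsf L_2)$ is an $F$-quasi-Leibniz quantum compact metric space $(\mathfrak D,\mathsf L_{\mathfrak D})$ with quantum isometries $\pi_j:(\mathfrak D,\mathsf L_{\mathfrak D})\to(\mathfrak A_j,\mathsf L_j)$. Its *extent* is $\max_{j=1,2}\mathrm{Haus}_{\mathsf{mk}_{\mathsf L_{\mathfrak D}}}(\mathscr S(\mathfrak D),\{\varphi\circ\pi_j:\varphi\in\mathscr S(\mathfrak A_j)\})$, with $\mathrm{Haus}_d$ the Hausdorff distance for $d$. An *$(F,H)$-modular tunnel* $\tau=(\mathbb D,(\theta_{\mathfrak A},\Theta_{\mathfrak A}),(\theta_{\mathfrak B},\Theta_{\mathfrak B}))$ from $\mathbb A=\mathrm{dom}(\tau)$ to $\mathbb B=\mathrm{codom}(\tau)$ (both $(F,H)$-metrized quantum vector bundles) is an $(F,H)$-metrized quantum vector bundle $\mathbb D$ with base $(\mathfrak D,\mathsf L_{\mathfrak D})$ and two modular quantum isometries from $\mathbb D$ to $\mathbb A$ and to $\mathbb B$. Its *extent* $\chi(\tau)$ is the extent of its basic tunnel $\tau_\flat=(\mathfrak D,\mathsf L_{\mathfrak D},\theta_{\mathfrak A},\theta_{\mathfrak B})$. **Appropriate classes.** A class $\mathcal T$ of $(F,H)$-modular tunnels is *appropriate* for a nonempty class $\mathcal C$ of $(F,H)$-metrized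 quantum vector bundles when: (1) $\tau\in\mathcal T$ implies $\mathrm{dom}(\tau),\mathrm{codom}(\tau)\in\mathcal C$; (2) for $\mathbb A,\mathbb B\in\mathcal C$ there is $\tau\in\mathcal T$ from $\mathbb A$ to $\mathbb B$; (3) if $\Theta:\mathbb A\to\mathbb B$ is a full modular quantum isometry between elements of $\mathcal C$, then $(\mathbb A,\mathrm{id},\Theta)\in\mathcal T$, where $\mathrm{id}$ is the pair of identity maps; (4) if $(\mathbb D,\Theta,\Pi)\in\mathcal T$ then $(\mathbb D,\Pi,\Theta)\in\mathcal T$; (5) if $\tau_1,\tau_2\in\mathcal T$ with $\mathrm{codom}(\tau_1)=\mathrm{dom}(\tau_2)$ and $\varepsilon>0$, there is $\tau\in\mathcal T$ from $\mathrm{dom}(\tau_1)$ to $\mathrm{codom}(\tau_2)$ with $\chi(\tau)\le\chi(\tau_1)+\chi(\tau_2)+\varepsilon$. *)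

(* Defs.v *)
From HB Require Import structures.
From mathcomp Require Import all_boot all_order all_algebra.
From mathcomp Require Import all_classical all_reals all_analysis.
From mathcomp Require Export complex.

Set Implicit Arguments.
Unset Strict Implicit.
Unset Printing Implicit Defensive.
Import Order.TTheory GRing.Theory Num.Theory.
Import numFieldNormedType.Exports.
Local Open Scope classical_set_scope.
Local Open Scope complex_scope.
Local Open Scope ring_scope.

(* The norm of a normed module over R[i] takes its values in R[i]; this is the
   same norm as an element of R. *)
Definition rnorm (R : realType) (V : normedZmodType R[i]) (v : V) : R :=
  complex.Re `|v|.

(* F : [0, oo)^4 -> [0, oo) and H : [0, oo)^2 -> [0, oo) are represented by
   total functions on R of which only the restriction to nonnegative arguments
   is ever used; the lower bounds make these restrictions nonnegative. *)
Definition permissible (R : realType) (F : R -> R -> R -> R -> R) : Prop :=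
  (forall x y lx ly x' y' lx' ly' : R,
      0 <= x <= x' -> 0 <= y <= y' -> 0 <= lx <= lx' -> 0 <= ly <= ly' ->
      F x y lx ly <= F x' y' lx' ly') /\
  (forall x y lx ly : R, 0 <= x -> 0 <= y -> 0 <= lx -> 0 <= ly ->
      x * ly + y * lx <= F x y lx ly).

Definition permissible_pair (R : realType) (F : R -> R -> R -> R -> R)
    (H : R -> R -> R) : Prop :=
  [/\ permissible F,
      (forall x y x' y' : R, 0 <= x <= x' -> 0 <= y <= y' -> H x y <= H x' y')
    & (forall x y : R, 0 <= x -> 0 <= y -> 2 * x * y <= H x y)].

(* Unital C*-algebras. The product is a field of the mixin, and not the one of an
   algType: the hierarchy has no join of GRing.PzSemiRing and
   Num.SemiNormedZmodule below Num.NumDomain, so that no structure can inherit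
   from both algType and normedModType. *)
HB.mixin Record isCStarAlgebra (R : realType) A of CompleteNormedModule R[i] A := {
  cmul : A -> A -> A ;
  cunit : A ;
  star : A -> A ;
  cmulA : associative cmul ;
  cmul1l : left_id cunit cmul ;
  cmul1r : right_id cunit cmul ;
  cmulDl : left_distributive cmul +%R ;
  cmulDr : right_distributive cmul +%R ;
  cmulZl : forall (z : R[i]) (a b : A), cmul (z *: a) b = z *: cmul a b ;
  cmulZr : forall (z : R[i]) (a b : A), cmul a (z *: b) = z *: cmul a b ;
  cunit_neq0 : cunit != 0 ;
  starK : involutive star ;
  starD : forall a b : A, star (a + b) = star a + star b ;
  starZ : forall (z : R[i]) (a : A), star (z *: a) = z^*%C *: star a ;
  starM : forall a b : A, star (cmul a b) = cmul (star b) (star a) ;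
  cstar_normM : forall a b : A, `|cmul a b| <= `|a| * `|b| ;
  cstar_normV : forall a : A, `|cmul (star a) a| = `|a| ^+ 2
}.

#[short(type="cstarAlgType")]
HB.structure Definition CStarAlgebra (R : realType) :=
  {A of isCStarAlgebra R A & CompleteNormedModule R[i] A}.

Local Notation "a ** b" := (cmul a b) (at level 40, left associativity).

Section CStarAlgebraTheory.
Variables (R : realType) (A : cstarAlgType R).
Implicit Types (a b : A) (z : R[i]).

Definition sa : set A := [set a | star a = a].

Definition Re_part a : A := (2^-1 : R[i]) *: (a + star a).
Definition Im_part a : A := ((2 * 'i%C)^-1 : R[i]) *: (a - star a).

Definition invertible a := exists b, a ** b = cunit /\ b ** a = cunit.

Definition spectrum a : set R[i] := [set z | ~ invertible (a - z *: cunit)].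

(* The order of R[i] is the partial one: 0 <= z means that z is real and
   nonnegative. *)
Definition cstar_ge0 a := sa a /\ (forall z, spectrum a z -> 0 <= z).

Definition state_space : set (A -> R[i]) := [set phi |
  [/\ linear_for *%R phi, (forall a, cstar_ge0 a -> 0 <= phi a) & phi cunit = 1]].

(* Lipschitz seminorms are functions A -> \bar R equal to +oo off their domain,
   in particular on elements which are not self-adjoint. *)
Definition mk (L : A -> \bar R) (phi psi : A -> R[i]) : \bar R :=
  ereal_sup [set (rnorm (phi a - psi a))%:E | a in [set a | (L a <= 1)%E]].

Definition ldom (L : A -> \bar R) : set A := [set a | (L a < +oo)%E].

Record Jordan_Lie_subalgebra (S : set A) : Prop := {
  jl_sa : S `<=` sa ;
  jl_0 : S 0 ;
  jl_D : forall a b, S a -> S b -> S (a + b) ;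
  jl_Z : forall (r : R) a, S a -> S (r%:C *: a) ;
  jl_Re : forall a b, S a -> S b -> S (Re_part (a ** b)) ;
  jl_Im : forall a b, S a -> S b -> S (Im_part (a ** b))
}.

(* The weak* topology is the topology of pointwise convergence. *)
Definition metrizes_weak_star (d : (A -> R[i]) -> (A -> R[i]) -> \bar R) : Prop :=
  (forall phi psi, state_space phi -> state_space psi ->
     (0 <= d phi psi < +oo)%E) /\
  (forall (phi : {ptws A -> R[i]^o}) (U : set {ptws A -> R[i]^o}),
     state_space phi ->
     within state_space (nbhs phi) U <->
     exists2 e : R, 0 < e &
       forall psi, state_space psi -> (d phi psi < e%:E)%E -> U psi).

Record is_qcms (F : R -> R -> R -> R -> R) (L : A -> \bar R) : Prop := {
  L_dom : Jordan_Lie_subalgebra (ldom L) ;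
  L_dense : sa `<=` closure (ldom L) ;
  L_ge0 : forall a, (0 <= L a)%E ;
  L_D : forall a b, ldom L a -> ldom L b -> (L (a + b)%R <= L a + L b)%E ;
  L_Z : forall (r : R) a, ldom L a -> L (r%:C *: a) = (`|r|%:E * L a)%E ;
  L_eq0 : forall a, L a = 0%E <-> exists r : R, a = r%:C *: cunit ;
  L_mk : metrizes_weak_star (mk L) ;
  L_lsc : lower_semicontinuous L ;
  L_Leibniz : forall a b, ldom L a -> ldom L b ->
    (maxe (L (Re_part (a ** b)%R)) (L (Im_part (a ** b)%R)) <=
     (F (rnorm a) (rnorm b) (fine (L a)) (fine (L b)))%:E)%E
}.

End CStarAlgebraTheory.
Arguments state_space {R} A _.

Record qcms (R : realType) (F : R -> R -> R -> R -> R) := QCMS {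
  qalg :> cstarAlgType R ;
  Lip : qalg -> \bar R ;
  qcmsP : is_qcms F Lip
}.

Record star_morphism (R : realType) (A B : cstarAlgType R) := StarMorphism {
  smap :> {linear A -> B} ;
  smap1 : smap cunit = cunit ;
  smapM : forall a b, smap (a ** b) = smap a ** smap b ;
  smap_star : forall a, smap (star a) = star (smap a)
}.

Section QuantumIsometries.
Variables (R : realType) (F : R -> R -> R -> R -> R).

Definition quantum_isometry (A B : qcms F) (pi : star_morphism A B) : Prop :=
  (forall b : B, exists a : A, pi a = b) /\
  (forall b : B, sa b ->
     Lip b = ereal_inf [set Lip a | a in [set a : A | sa a /\ pi a = b]]).

Definition full_quantum_isometry (A B : qcms F) (pi : star_morphism A B) : Prop :=
  bijective pi /\ (forall a : A, Lip (pi a) = Lip a).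

Record basic_tunnel (A B : qcms F) := BasicTunnel {
  bt_space : qcms F ;
  bt_left : star_morphism bt_space A ;
  bt_right : star_morphism bt_space B ;
  bt_leftP : quantum_isometry bt_left ;
  bt_rightP : quantum_isometry bt_right
}.

Definition Hausdorff_distance (T : Type) (d : T -> T -> \bar R) (X Y : set T) :
    \bar R :=
  maxe (ereal_sup [set ereal_inf [set d x y | y in Y] | x in X])
       (ereal_sup [set ereal_inf [set d x y | x in X] | y in Y]).

Definition basic_extent (A B : qcms F) (tau : basic_tunnel A B) : \bar R :=
  let mkD := mk (@Lip _ _ (bt_space tau)) in
  let SD := state_space (bt_space tau) in
  maxe (Hausdorff_distance mkD SD
          [set (fun d => phi (bt_left tau d)) | phi in state_space A])
       (Hausdorff_distance mkD SD
          [set (fun d => phi (bt_right tau d)) | phi in state_space B]).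

End QuantumIsometries.

(* Left Hilbert modules. The A-action is a separate operation because the
   canonical scaling of M is the one by R[i]. *)
HB.mixin Record isHilbertModule (R : realType) (A : cstarAlgType R) M
    of CompleteNormedModule R[i] M := {
  act : A -> M -> M ;
  act1 : forall w : M, act cunit w = w ;
  actM : forall (a b : A) (w : M), act (a ** b) w = act a (act b w) ;
  actDl : forall (a b : A) (w : M), act (a + b) w = act a w + act b w ;
  actDr : forall (a : A) (w v : M), act a (w + v) = act a w + act a v ;
  actZl : forall (z : R[i]) (a : A) (w : M), act (z *: a) w = z *: act a w ;
  actZr : forall (z : R[i]) (a : A) (w : M), act a (z *: w) = z *: act a w ;
  inner : M -> M -> A ;
  innerDl : forall w v u : M, inner (w + v) u = inner w u + inner v u ;
  innerDr : forall w v u : M, inner w (v + u) = inner w v + inner w u ;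
  innerZl : forall (z : R[i]) (w v : M), inner (z *: w) v = z *: inner w v ;
  innerZr : forall (z : R[i]) (w v : M), inner w (z *: v) = z^*%C *: inner w v ;
  inner_act : forall (a : A) (w v : M), inner (act a w) v = a ** inner w v ;
  inner_star : forall w v : M, inner w v = star (inner v w) ;
  inner_ge0 : forall w : M, cstar_ge0 (inner w w) ;
  inner_eq0 : forall w : M, inner w w = 0 <-> w = 0 ;
  hilbert_norm : forall w : M, rnorm w = Num.sqrt (rnorm (inner w w))
}.

#[short(type="hilbertModType")]
HB.structure Definition HilbertModule (R : realType) (A : cstarAlgType R) :=
  {M of isHilbertModule R A M & CompleteNormedModule R[i] M}.

Definition ddom (R : realType) (T : Type) (D : T -> \bar R) : set T :=
  [set w | (D w < +oo)%E].

Record is_Dnorm (R : realType) (F : R -> R -> R -> R -> R) (H : R -> R -> R)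
    (A : qcms F) (M : hilbertModType A) (D : M -> \bar R) : Prop := {
  D_dense : dense (ddom D) ;
  D_ge0 : forall w, (0 <= D w)%E ;
  D_eq0 : forall w, D w = 0%E <-> w = 0 ;
  D_D : forall w v, ddom D w -> ddom D v -> (D (w + v)%R <= D w + D v)%E ;
  D_Z : forall (z : R[i]) w, ddom D w -> D (z *: w) = ((rnorm z)%:E * D w)%E ;
  D_norm : forall w, ((rnorm w)%:E <= D w)%E ;
  D_compact : compact [set w | (D w <= 1)%E] ;
  D_inner : forall w v, ddom D w -> ddom D v ->
    (maxe (Lip (Re_part (inner w v))) (Lip (Im_part (inner w v))) <=
     (H (fine (D w)) (fine (D v)))%:E)%E
}.

(* (F, H)-metrized quantum vector bundles. *)
Record mqvb (R : realType) (F : R -> R -> R -> R -> R) (H : R -> R -> R) := MQVB {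
  base : qcms F ;
  bmod : hilbertModType base ;
  Dn : bmod -> \bar R ;
  mqvbP : is_Dnorm H Dn
}.

Section ModularTunnels.
Variables (R : realType) (F : R -> R -> R -> R -> R) (H : R -> R -> R).
Local Notation bundle := (mqvb F H).

Record hilbert_morphism (A B : bundle) := HilbertMorphism {
  hbase : star_morphism (base A) (base B) ;
  hmod : {linear bmod A -> bmod B} ;
  hmod_act : forall (a : base A) (w : bmod A),
    hmod (act a w) = act (hbase a) (hmod w) ;
  hmod_inner : forall w v : bmod A, hbase (inner w v) = inner (hmod w) (hmod v)
}.

Definition modular_quantum_isometry (A B : bundle) (f : hilbert_morphism A B) :
    Prop :=
  [/\ quantum_isometry (hbase f),
      (forall v : bmod B, exists w : bmod A, hmod f w = v)
    & (forall v : bmod B,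
         Dn v = ereal_inf [set Dn w | w in [set w : bmod A | hmod f w = v]])].

Definition full_modular_quantum_isometry (A B : bundle)
    (f : hilbert_morphism A B) : Prop :=
  [/\ full_quantum_isometry (hbase f), bijective (hmod f)
    & (forall w : bmod A, Dn (hmod f w) = Dn w)].

Lemma full_modular_quantum_isometryW (A B : bundle) (f : hilbert_morphism A B) :
  full_modular_quantum_isometry f -> modular_quantum_isometry f.
Proof.
move=> [[[g fK gK] fL] [h hK kK] fD]; split.
- split=> [b|b sab]; first by exists (g b).
  rewrite -[in LHS](gK b) fL -[LHS]ereal_inf1; congr ereal_inf.
  apply/seteqP; split=> [_ ->|_ [a [_ ab] <-]] /=; last by rewrite -(fK a) ab.
  exists (g b) => //; split => //.
  by apply: (can_inj fK); rewrite smap_star gK.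
- by move=> v; exists (h v).
- move=> v; rewrite -[in LHS](kK v) fD -[LHS]ereal_inf1; congr ereal_inf.
  apply/seteqP; split=> [_ ->|_ [w wv <-]] /=; last by rewrite -(hK w) wv.
  by exists (h v).
Qed.

Definition star_morphism_id (A : cstarAlgType R) : star_morphism A A :=
  @StarMorphism R A A idfun erefl (fun _ _ => erefl) (fun=> erefl).

Definition hilbert_morphism_id (A : bundle) : hilbert_morphism A A :=
  @HilbertMorphism A A (star_morphism_id (base A)) idfun
    (fun _ _ => erefl) (fun _ _ => erefl).

Lemma full_modular_quantum_isometry_id (A : bundle) :
  full_modular_quantum_isometry (hilbert_morphism_id A).
Proof. by split; [split| |] => //; exists idfun. Qed.

Record modular_tunnel (A B : bundle) := ModularTunnel {
  mt_bundle : bundle ;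
  mt_left : hilbert_morphism mt_bundle A ;
  mt_right : hilbert_morphism mt_bundle B ;
  mt_leftP : modular_quantum_isometry mt_left ;
  mt_rightP : modular_quantum_isometry mt_right
}.

Lemma modular_quantum_isometry_base (A B : bundle) (f : hilbert_morphism A B) :
  modular_quantum_isometry f -> quantum_isometry (hbase f).
Proof. by case. Qed.

Definition flat (A B : bundle) (tau : modular_tunnel A B) :
    basic_tunnel (base A) (base B) :=
  BasicTunnel (modular_quantum_isometry_base (mt_leftP tau))
    (modular_quantum_isometry_base (mt_rightP tau)).

Definition extent (A B : bundle) (tau : modular_tunnel A B) : \bar R :=
  basic_extent (flat tau).

Definition inverse_tunnel (A B : bundle) (tau : modular_tunnel A B) :
    modular_tunnel B A :=
  ModularTunnel (mt_rightP tau) (mt_leftP tau).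

Definition full_isometry_tunnel (A B : bundle) (f : hilbert_morphism A B)
    (fP : full_modular_quantum_isometry f) : modular_tunnel A B :=
  ModularTunnel
    (full_modular_quantum_isometryW (full_modular_quantum_isometry_id A))
    (full_modular_quantum_isometryW fP).

(* A class of tunnels is a family of predicates indexed by the domain and the
   codomain, so that codom t1 = dom t2 is a typing constraint. *)
Definition tunnel_class := forall A B : bundle, modular_tunnel A B -> Prop.

Record appropriate (C : bundle -> Prop) (T : tunnel_class) : Prop := {
  appr_dom : forall (A B : bundle) (tau : modular_tunnel A B),
    T A B tau -> C A /\ C B ;
  appr_ex : forall A B : bundle, C A -> C B ->
    exists tau : modular_tunnel A B, T A B tau ;
  appr_full : forall (A B : bundle) (f : hilbert_morphism A B)
    (fP : full_modular_quantum_isometry f), C A -> C B ->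
    T A B (full_isometry_tunnel fP) ;
  appr_inv : forall (A B : bundle) (tau : modular_tunnel A B),
    T A B tau -> T B A (inverse_tunnel tau) ;
  appr_comp : forall (A B E : bundle)
    (tau1 : modular_tunnel A B) (tau2 : modular_tunnel B E) (e : R),
    T A B tau1 -> T B E tau2 -> 0 < e ->
    exists2 tau : modular_tunnel A E, T A E tau &
      (extent tau <= extent tau1 + extent tau2 + e%:E)%E
}.

Definition dual_modular_propinquity (T : tunnel_class) (A B : bundle) : \bar R :=
  ereal_inf [set x | exists2 tau : modular_tunnel A B, T A B tau & extent tau = x].

End ModularTunnels.

Record pseudometric_on (R : realType) (X : Type) (C : X -> Prop)
    (d : X -> X -> \bar R) : Prop := {
  pm_ge0_fin : forall x y, C x -> C y -> (0 <= d x y < +oo)%E ;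
  pm_refl : forall x, C x -> d x x = 0%E ;
  pm_sym : forall x y, C x -> C y -> d x y = d y x ;
  pm_triangle : forall x y z, C x -> C y -> C z -> (d x z <= d x y + d y z)%E
}.

(* Main.v *)
Require Import Defs.
From HB Require Import structures.
From mathcomp Require Import all_boot all_order all_algebra.
From mathcomp Require Import all_classical all_reals all_analysis.
From mathcomp Require Import ring lra.

(* A self-adjoint element of a C*-algebra attains its norm at a state (spectral
   radius formula and Hahn-Banach), so in a tunnel of extent chi an element d of
   Lipschitz seminorm at most l satisfies |d| <= |pi d| + l chi for each of the
   two quantum isometries pi.

   If the propinquity of A and B vanishes, choose tunnels tau_n of extents tending
   to 0 and an ultrafilter U on the integers. Relate a to b when there are
   d_n in the n-th tunnel, of uniformly bounded Lipschitz seminorms, whose images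
   in A and B converge to a and b along U. By the estimate above this relation is
   bi-Lipschitz; it is compatible with the algebraic operations by the Leibniz
   inequality, and every element of finite seminorm is related to one of at most
   the same seminorm, because Lipschitz balls are compact. The relation is symmetric in
   A and B, so its closure is the graph of a full quantum isometry. The same
   construction with the D-norms on the modules, combined with the inner product,
   yields the module isomorphism. *)

Set Implicit Arguments.
Unset Strict Implicit.
Unset Printing Implicit Defensive.
Import Order.TTheory GRing.Theory Num.Theory.
Import numFieldNormedType.Exports.
Local Open Scope classical_set_scope.
Local Open Scope complex_scope.
Local Open Scope ring_scope.

Local Notation "a ** b" := (cmul a b) (at level 40, left associativity).


(** * Real-valued norms and limits *)

Section RealValuedNorm.
Variable R : realType.

Section Normed.
Variable V : normedZmodType R[i].
Implicit Types v w : V.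

(** The extent sees only the base algebras, so the modules have no estimate of their own: [rnorm w]
    is controlled through [inner w w], for which [H] supplies a Lipschitz bound. No inequality
    relates the D-norm to the action, so lifts of [a] and [w] give no lift of [act a w] with bounded
    D-norm; that the two maps intertwine the actions is deduced from the inner product and
    surjectivity instead.

    States are compared with the norm on self-adjoint elements, and other elements are split into
    real and imaginary parts. This costs a factor 2, so the relations are only bounded with constant
    2; the exact equalities for [Lip] and [Dn] come from lifts with almost optimal seminorms.

    Positivity is defined by the spectrum. Norming states therefore rest on two facts: the spectrum
    of a self-adjoint element is real, and it contains the norm or its opposite. The functional
    dominating in Hahn-Banach is the top of the spectrum of the real part; its sublinearity amounts
    to the positive elements being a cone. *)

Lemma rnormE v : `|v| = (rnorm v)%:C.
Proof. by rewrite /rnorm RRe_real// ger0_real. Qed.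

Lemma rnorm_ge0 v : 0 <= rnorm v.
Proof. by rewrite -ler0c -rnormE. Qed.

Lemma rnorm0 : rnorm (0 : V) = 0.
Proof. by rewrite /rnorm normr0. Qed.

Lemma rnorm0_eq0 v : rnorm v = 0 -> v = 0.
Proof. by move=> v0; apply/normr0_eq0; rewrite rnormE v0. Qed.

Lemma rnormN v : rnorm (- v) = rnorm v.
Proof. by rewrite /rnorm normrN. Qed.

Lemma rnormBC v w : rnorm (v - w) = rnorm (w - v).
Proof. by rewrite /rnorm distrC. Qed.

Lemma rnormD v w : rnorm (v + w) <= rnorm v + rnorm w.
Proof. by rewrite -lecR rmorphD/= -!rnormE ler_normD. Qed.

Lemma rnormB v w : rnorm (v - w) <= rnorm v + rnorm w.
Proof. by rewrite -(rnormN w) rnormD. Qed.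

Lemma rnorm_dist v w u : rnorm (v - u) <= rnorm (v - w) + rnorm (w - u).
Proof. by rewrite -[v - u](subrKA w) rnormD. Qed.

Lemma le_rnormB v w : rnorm v - rnorm w <= rnorm (v - w).
Proof. by rewrite lerBlDr -{1}(subrK w v) rnormD. Qed.

Lemma rnorm_le0 v : rnorm v <= 0 -> v = 0.
Proof.
by move=> v0; apply: rnorm0_eq0; apply/eqP; rewrite eq_le v0 rnorm_ge0.
Qed.

Lemma rnorm_small0 v : (forall e : R, 0 < e -> rnorm v <= e) -> v = 0.
Proof. by move=> h; apply/rnorm_le0/ler_addgt0Pr => e e0; rewrite add0r h. Qed.

End Normed.

Lemma rnormC (r : R) : rnorm (r%:C : R[i]) = `|r|.
Proof. by rewrite /rnorm normc_def/= expr0n addr0 sqrtr_sqr. Qed.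

Lemma rnormM (y z : R[i]) : rnorm (y * z) = rnorm y * rnorm z.
Proof. by apply: complexI; rewrite rmorphM/= -!rnormE normrM. Qed.

Lemma rnorm1 : rnorm (1 : R[i]) = 1.
Proof. by rewrite /rnorm normr1. Qed.

Lemma rnormV (z : R[i]) : rnorm z^-1 = (rnorm z)^-1.
Proof. by apply: complexI; rewrite fmorphV/= -!rnormE normfV. Qed.

Lemma rnorm_i : rnorm ('i : R[i]) = 1.
Proof. by rewrite /rnorm normc_def/= expr0n expr1n add0r sqrtr1. Qed.


Lemma rnorm_sqr (z : R[i]) : rnorm z ^+ 2 = complex.Re z ^+ 2 + complex.Im z ^+ 2.
Proof. by rewrite /rnorm normc_def/= sqr_sqrtr// addr_ge0// sqr_ge0. Qed.

Lemma ge_Re_rnorm (z : R[i]) : `|complex.Re z| <= rnorm z.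
Proof. by rewrite -lecR -rnormE normc_ge_Re. Qed.

Lemma rnormZ (V : normedModType R[i]) (z : R[i]) (v : V) :
  rnorm (z *: v) = rnorm z * rnorm v.
Proof. by apply: complexI; rewrite rmorphM/= -!rnormE normrZ. Qed.

Lemma gt0_realC (e : R[i]) : 0 < e -> exists2 r : R, 0 < r & e = r%:C.
Proof.
move=> e0; exists (complex.Re e); last by rewrite RRe_real// gtr0_real.
by rewrite -ltcR RRe_real// gtr0_real.
Qed.

Lemma cvg_rnormP (V : normedModType R[i]) (F : set_system V) {FF : Filter F} (x : V) :
  F --> x <-> forall e : R, 0 < e -> \forall y \near F, rnorm (x - y) < e.
Proof.
split=> [/cvgrPdist_lt h e e0|h].
  have e0' : 0 < e%:C by rewrite ltcR.
  by near=> y; rewrite -ltcR -rnormE; near: y; exact: h.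
apply/cvgrPdist_lt => _ /gt0_realC [r r0 ->].
by near=> y; rewrite rnormE ltcR; near: y; exact: h.
Unshelve. all: by end_near. Qed.

Lemma cvg_rnorm_mapP (V : normedModType R[i]) (T : Type) (F : set_system T)
    {FF : Filter F} (u : T -> V) (x : V) :
  u @ F --> x <->
  forall e : R, 0 < e -> \forall t \near F, rnorm (x - u t) < e.
Proof. exact: cvg_rnormP. Qed.

Lemma nbhs_rnorm (V : normedModType R[i]) (x : V) (e : R) : 0 < e ->
  \forall y \near x, rnorm (x - y) < e.
Proof. by move: e; apply/(@cvg_rnormP _ (nbhs x)). Qed.


Lemma closure_rnormP (V : normedModType R[i]) (S : set V) (x : V) :
  closure S x -> forall e : R, 0 < e -> exists2 y, S y & rnorm (x - y) < e.
Proof. by move=> h e /(nbhs_rnorm x)/h [y [? ?]]; exists y. Qed.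

Lemma dense_rnorm (V : normedModType R[i]) (S : set V) (x : V) (e : R) :
  dense S -> 0 < e -> exists2 y, S y & rnorm (x - y) < e.
Proof.
move=> dS e0; have e0' : 0 < e%:C by rewrite ltcR.
have [||y [xy Sy]] := dS (ball x e%:C).
- by exists x; exact: ballxx.
- exact: ball_open.
by exists y => //; move: xy; rewrite -ball_normE /= rnormE ltcR.
Qed.

Lemma cauchy_rnorm (V : completeNormedModType R[i]) (F : set_system V)
    {FF : ProperFilter F} :
  (forall e : R, 0 < e -> exists2 P, F P & forall x y, P x -> P y -> rnorm (x - y) < e) ->
  exists x : V, F --> x.
Proof.
move=> h; suff /cauchy_cvg cF : cauchy F by exists (lim F).
apply/cauchyP => _ /gt0_realC [r r0 ->].
have [P FP Ph] := h r r0; have [x Px] := filter_ex FP.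
exists x; apply: filterS FP => y Py.
by rewrite -ball_normE /= rnormE ltcR Ph.
Qed.

Lemma cauchy_seq_rnorm (V : completeNormedModType R[i]) (u : nat -> V) :
  (forall e : R, 0 < e -> exists n, forall i j, (n <= i)%N -> (n <= j)%N ->
    rnorm (u i - u j) < e) ->
  exists x : V, u @ \oo --> x.
Proof.
move=> h; apply: cauchy_rnorm => e /h[n hn].
exists (u @` [set i | (n <= i)%N]); first by exists n => // i /= ni; exists i.
by move=> _ _ [i ni <-] [j nj <-]; exact: hn.
Qed.

(** Asking only for compatibility with subtraction covers both the product and the inner product,
    which is conjugate-linear in its second argument. *)
Lemma bilinear_cvg (V1 V2 V3 : normedModType R[i]) (f : V1 -> V2 -> V3) (c : R)
    (T : Type) (F : set_system T) {FF : Filter F} (u : T -> V1) (v : T -> V2) x y :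
  (forall a b w, f (a - b) w = f a w - f b w) ->
  (forall a w w', f a (w - w') = f a w - f a w') ->
  (forall a w, rnorm (f a w) <= c * rnorm a * rnorm w) ->
  u @ F --> x -> v @ F --> y -> (fun t => f (u t) (v t)) @ F --> f x y.
Proof.
move=> fBl fBr fc /cvg_rnorm_mapP ux /cvg_rnorm_mapP vy; apply/cvg_rnorm_mapP => e e0.
pose C := `|c| + 1; pose K1 := rnorm x + 1; pose K2 := rnorm y + 1.
have C0 : 0 < C by rewrite ltr_pwDr.
have K10 : 0 < K1 by rewrite ltr_pwDr// rnorm_ge0.
have K20 : 0 < K2 by rewrite ltr_pwDr// rnorm_ge0.
have {}fc a w : rnorm (f a w) <= C * (rnorm a * rnorm w).
  apply: (le_trans (fc _ _)); rewrite -mulrA ler_wpM2r ?mulr_ge0 ?rnorm_ge0//.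
  by have := ler_norm c; rewrite /C; lra.
have h1 : 0 < e / 2 / C / K2 by rewrite !divr_gt0.
have h2 : 0 < e / 2 / C / K1 by rewrite !divr_gt0.
apply: filterS (filterI (ux _ ltr01) (filterI (ux _ h1) (vy _ h2))) => t [a1 [a2 a3]].
have uK : rnorm (u t) <= K1.
  by have := le_rnormB (u t) x; rewrite rnormBC /K1; lra.
rewrite -(subrKA (f (u t) y)) -fBl -fBr; apply: (le_lt_trans (rnormD _ _)).
rewrite (splitr e) ltrD//; apply: (le_lt_trans (fc _ _)); rewrite mulrC -ltr_pdivlMr//.
- apply: le_lt_trans (_ : rnorm (x - u t) * K2 < _); last by rewrite -ltr_pdivlMr.
  by rewrite ler_wpM2l ?rnorm_ge0// lerDl.
- apply: le_lt_trans (_ : K1 * rnorm (y - v t) < _); last by rewrite mulrC -ltr_pdivlMr.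
  by rewrite ler_wpM2r ?rnorm_ge0.
Qed.

Lemma cvg_rnorm_unique (V : normedModType R[i]) (T : Type) (F : set_system T)
    {FF : ProperFilter F} (u : T -> V) (x y : V) :
  u @ F --> x -> u @ F --> y -> x = y.
Proof.
move=> /cvg_rnorm_mapP ux /cvg_rnorm_mapP uy; apply/eqP; rewrite -subr_eq0.
apply/eqP/rnorm_small0 => e e0; have e20 : 0 < e / 2 by rewrite divr_gt0.
have [t [xt yt]] := filter_ex (filterI (ux _ e20) (uy _ e20)).
by apply: (le_trans (rnorm_dist _ (u t) _)); rewrite (rnormBC _ y) (splitr e) ltW// ltrD.
Qed.

Lemma cvg_rnorm_le (V : normedModType R[i]) (T : Type) (F : set_system T)
    {FF : ProperFilter F} (u : T -> V) (x : V) (M : R) :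
  u @ F --> x -> (\forall t \near F, rnorm (u t) <= M) -> rnorm x <= M.
Proof.
move=> /cvg_rnorm_mapP ux uM; apply/ler_addgt0Pr => e e0.
have [t [xt tM]] := filter_ex (filterI (ux e e0) uM).
rewrite -[x](subrK (u t)) addrC; apply: (le_trans (rnormD _ _)).
by rewrite lerD// ltW.
Qed.

Lemma ultra_fmap (T S : Type) (F : set_system T) (u : T -> S) :
  UltraFilter F -> UltraFilter (u @ F).
Proof.
move=> FU; split; first exact: fmap_proper_filter.
move=> G GF uFG; apply/seteqP; split => // P GP.
have [//|FnP] := in_ultra_setVsetC (u @^-1` P) FU.
have : G (~` P) by exact: uFG.
by move=> /(filterI GP)/filter_ex[y []].
Qed.

Lemma ultra_bounded_cvgR (T : Type) (F : set_system T) (u : T -> R) (M : R) :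
  UltraFilter F -> (\forall t \near F, `|u t| <= M) -> exists l : R, u @ F --> l.
Proof.
move=> FU uM; have := @segment_compact _ (- M) M; rewrite compact_ultra => h.
have [||l [_ ul]] := h (u @ F); first exact: ultra_fmap.
  by apply: filterS uM => t; rewrite /= in_itv/= ler_norml.
by exists l.
Qed.

Lemma cvg_complex (T : Type) (F : set_system T) {FF : Filter F} (u v : T -> R) (x y : R) :
  u @ F --> x -> v @ F --> y ->
  (fun t => u t +i* v t : R[i]^o) @ F --> (x +i* y : R[i]^o).
Proof.
move=> /cvgrPdist_lt ux /cvgrPdist_lt vy; apply/cvg_rnorm_mapP => e e0.
have e20 : 0 < e / 2 by rewrite divr_gt0.
apply: filterS (filterI (ux _ e20) (vy _ e20)) => t [xt yt].
have -> : (x +i* y) - (u t +i* v t) = (x - u t)%:C + 'i * (y - v t)%:C.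
  by simpc.
apply: (le_lt_trans (rnormD _ _)); rewrite rnormM rnorm_i mul1r !rnormC.
by rewrite (splitr e) ltrD.
Qed.

Lemma ge_Im_rnorm (z : R[i]) : `|complex.Im z| <= rnorm z.
Proof.
rewrite -(@ler_pXn2r _ 2) ?nnegrE ?rnorm_ge0// rnorm_sqr real_normK ?num_real//.
by rewrite lerDr sqr_ge0.
Qed.

Lemma ultra_bounded_cvgC (T : Type) (F : set_system T) (u : T -> R[i]) (M : R) :
  UltraFilter F -> (\forall t \near F, rnorm (u t) <= M) ->
  exists l : R[i], (u : T -> R[i]^o) @ F --> (l : R[i]^o).
Proof.
move=> FU uM.
have [|x ux] := @ultra_bounded_cvgR _ F (fun t => complex.Re (u t)) M.
  by apply: filterS uM => t; apply: le_trans; exact: ge_Re_rnorm.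
have [|y uy] := @ultra_bounded_cvgR _ F (fun t => complex.Im (u t)) M.
  by apply: filterS uM => t; apply: le_trans; exact: ge_Im_rnorm.
exists (x +i* y); have FF : ProperFilter F by exact: ultra_proper.
have -> : u = fun t => complex.Re (u t) +i* complex.Im (u t).
  by apply/funext => t; case: (u t).
exact: cvg_complex.
Qed.

Lemma compact_disc (M : R) : compact [set z : R[i]^o | rnorm z <= M].
Proof.
rewrite compact_ultra => F FU FM; have [l ul] := @ultra_bounded_cvgC _ F id M FU FM.
exists l; split; last exact: ul.
exact: (cvg_rnorm_le ul).
Qed.

End RealValuedNorm.


(** * Spectra in C*-algebras *)

Section Algebra.
Variables (R : realType) (A : cstarAlgType R).
Implicit Types (a b x y : A) (z w : R[i]) (r : R).
Local Notation one := (cunit : A).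

Lemma cmul0l a : 0 ** a = 0.
Proof. by rewrite -(scale0r 0) cmulZl !scale0r. Qed.


Lemma cmulNl a b : (- a) ** b = - (a ** b).
Proof. by rewrite -scaleN1r cmulZl scaleN1r. Qed.

Lemma cmulNr a b : a ** (- b) = - (a ** b).
Proof. by rewrite -scaleN1r cmulZr scaleN1r. Qed.

Lemma cmulBl a b x : (a - b) ** x = a ** x - b ** x.
Proof. by rewrite cmulDl cmulNl. Qed.

Lemma cmulBr a b x : x ** (a - b) = x ** a - x ** b.
Proof. by rewrite cmulDr cmulNr. Qed.

Lemma starN a : star (- a) = - star a.
Proof. by rewrite -scaleN1r starZ rmorphN rmorph1 scaleN1r. Qed.

Lemma starB a b : star (a - b) = star a - star b.
Proof. by rewrite starD starN. Qed.

Lemma star0 : star (0 : A) = 0.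
Proof. by rewrite -{1}(scale0r (0 : A)) starZ rmorph0 scale0r. Qed.

Lemma star1 : star one = one.
Proof. by have := starM (star one) one; rewrite cmul1r starK cmul1r. Qed.

Lemma starZr r a : star (r%:C *: a) = r%:C *: star a.
Proof. by rewrite starZ conjc_real. Qed.

Lemma rnorm_cmul a b : rnorm (a ** b) <= rnorm a * rnorm b.
Proof. by rewrite -lecR rmorphM/= -!rnormE cstar_normM. Qed.

Lemma rnorm_cmul_star a : rnorm (star a ** a) = rnorm a ^+ 2.
Proof. by apply: complexI; rewrite rmorphXn/= -!rnormE cstar_normV. Qed.

Lemma rnorm_star_le a : rnorm a <= rnorm (star a).
Proof.
have := rnorm_cmul (star a) a; rewrite rnorm_cmul_star expr2.
have [->|a0] := eqVneq (rnorm a) 0; first by rewrite rnorm_ge0.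
by rewrite ler_pM2r// lt_neqAle eq_sym a0 rnorm_ge0.
Qed.

Lemma rnorm_star a : rnorm (star a) = rnorm a.
Proof.
by apply/eqP; rewrite eq_le rnorm_star_le -{2}(starK a) rnorm_star_le.
Qed.

Lemma rnorm_cunit : rnorm one = 1.
Proof.
have := rnorm_cmul_star one; rewrite star1 cmul1l => h.
have : rnorm one != 0 by apply/eqP => /rnorm0_eq0/eqP; apply/negP/cunit_neq0.
by move=> n0; apply: (mulfI n0); rewrite mulr1 -expr2.
Qed.

Lemma rnorm_scale1 z : rnorm (z *: one) = rnorm z.
Proof. by rewrite rnormZ rnorm_cunit mulr1. Qed.

Lemma sa0 : sa (0 : A). Proof. exact: star0. Qed.

Lemma sa1 : sa one. Proof. exact: star1. Qed.

Lemma saD a b : sa a -> sa b -> sa (a + b).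
Proof. by rewrite /sa/= starD => -> ->. Qed.

Lemma saN a : sa a -> sa (- a).
Proof. by rewrite /sa/= starN => ->. Qed.

Lemma saB a b : sa a -> sa b -> sa (a - b).
Proof. by move=> ? /saN; apply: saD. Qed.

Lemma saZ r a : sa a -> sa (r%:C *: a).
Proof. by rewrite /sa/= starZr => ->. Qed.

Lemma sa_Re a : sa (Re_part a).
Proof.
by rewrite /sa/= /Re_part starZ starD starK addrC conjc_inv conjc_nat.
Qed.

Lemma sa_Im a : sa (Im_part a).
Proof.
rewrite /sa/= /Im_part starZ starB starK conjc_inv.
have -> : (2 * 'i)^*%C = - (2 * 'i) :> R[i].
  by rewrite mulr_natl rmorphMn/= -mulNrn; congr (_ *+ 2); simpc.
by rewrite invrN scaleNr -scalerN opprB.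
Qed.

Lemma half_double a : 2^-1 *: (a + a) = a.
Proof.
by have := splitr (1 : R[i]); rewrite mul1r scalerDr -scalerDl => <-; rewrite scale1r.
Qed.

Lemma Re_Im_part a : a = Re_part a + 'i *: Im_part a.
Proof.
rewrite /Re_part /Im_part scalerA invfM mulrCA mulfV ?mulr1; last first.
  by rewrite eq_complex/= oner_eq0 andbF.
by rewrite -scalerDr addrACA subrr addr0 half_double.
Qed.

Lemma Re_part_sa a : sa a -> Re_part a = a.
Proof.
by rewrite /sa/= /Re_part => ->; rewrite half_double.
Qed.

Lemma rnorm_half : rnorm (2^-1 : R[i]) = 2^-1.
Proof. by rewrite rnormV -[2]/(2%:R) -(rmorph_nat (real_complex R)) rnormC ger0_norm. Qed.

Lemma rnorm_Re_part a : rnorm (Re_part a) <= rnorm a.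
Proof.
rewrite /Re_part rnormZ rnorm_half.
have := rnormD a (star a); rewrite rnorm_star; lra.
Qed.

Lemma rnorm_Im_part a : rnorm (Im_part a) <= rnorm a.
Proof.
rewrite /Im_part rnormZ invfM rnormM rnorm_half rnormV rnorm_i invr1 mulr1.
have := rnormB a (star a); rewrite rnorm_star; lra.
Qed.

Definition is_inverse x y := x ** y = one /\ y ** x = one.

Lemma inverse_uniq x y y' : is_inverse x y -> is_inverse x y' -> y = y'.
Proof. by move=> [_ yx] [xy' _]; rewrite -(cmul1r y) -xy' cmulA yx cmul1l. Qed.

Lemma invertibleZ z x : z != 0 -> invertible x -> invertible (z *: x).
Proof.
move=> z0 [y [xy yx]]; exists (z^-1 *: y).
by rewrite !cmulZl !cmulZr !scalerA xy yx mulfV// mulVf// scale1r.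
Qed.

Lemma invertibleN x : invertible (- x) -> invertible x.
Proof.
move=> h; rewrite -[x]opprK -scaleN1r; apply: invertibleZ => //.
Qed.

(** Partial sums of the geometric series in [x], in Horner form. *)
Fixpoint neumann x n : A := if n is n'.+1 then one + x ** neumann x n' else one.

Lemma neumann_comm x n : x ** neumann x n = neumann x n ** x.
Proof.
elim: n => [|n ih] /=; first by rewrite cmul1l cmul1r.
by rewrite cmulDr cmulDl cmul1l cmul1r {1}ih cmulA.
Qed.

Lemma neumann_bound x n : rnorm x < 1 -> rnorm (neumann x n) <= (1 - rnorm x)^-1.
Proof.
move=> x1; elim: n => [|n ih] /=.
  by rewrite rnorm_cunit invf_ge1 ?subr_gt0// gerBl rnorm_ge0.
have d0 : 0 < 1 - rnorm x by rewrite subr_gt0.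
apply: (le_trans (rnormD _ _)); rewrite rnorm_cunit.
apply: (@le_trans _ _ (1 + rnorm x * (1 - rnorm x)^-1)).
  rewrite lerD2l; apply: (le_trans (rnorm_cmul _ _)).
  by rewrite ler_wpM2l// rnorm_ge0.
rewrite le_eqVlt; apply/orP; left; apply/eqP; field.
by rewrite gt_eqF.
Qed.

Lemma neumann_dist x n k : rnorm x < 1 ->
  rnorm (neumann x (n + k) - neumann x n) <= rnorm x ^+ n * ((1 - rnorm x)^-1 + 1).
Proof.
move=> x1; elim: n => [|n ih].
  rewrite add0n expr0 mul1r; apply: (le_trans (rnormB _ _)) => /=.
  by rewrite rnorm_cunit lerD2r neumann_bound.
rewrite addSn /= opprD addrACA subrr add0r -cmulBr exprS -mulrA.
by apply: (le_trans (rnorm_cmul _ _)); rewrite ler_wpM2l// rnorm_ge0.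
Qed.

Lemma expr_small (q e : R) : 0 <= q < 1 -> 0 < e -> exists n, q ^+ n < e.
Proof.
move=> /andP[q0 q1] e0; have := @cvg_expr R q; rewrite ger0_norm// => /(_ q1).
move/cvgrPdist_lt/(_ e e0) => [n _ /(_ n (leqnn n))] /=.
by rewrite sub0r normrN ger0_norm ?exprn_ge0// => h; exists n.
Qed.

Lemma neumann_cvg x : rnorm x < 1 -> exists y, neumann x @ \oo --> y.
Proof.
move=> x1; apply: cauchy_seq_rnorm => e e0.
set M := (1 - rnorm x)^-1 + 1.
have M0 : 0 < M by rewrite addr_gt0// invr_gt0 subr_gt0.
have [n hn] : exists n, rnorm x ^+ n < e / 2 / M.
  by apply: expr_small; rewrite ?rnorm_ge0// !divr_gt0.
have h i : (n <= i)%N -> rnorm (neumann x i - neumann x n) < e / 2.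
  move=> ni; rewrite -(subnKC ni); apply: (le_lt_trans (neumann_dist _ _ x1)).
  by rewrite -ltr_pdivlMr.
exists n => i j /h hi /h hj; apply: (le_lt_trans (rnorm_dist _ (neumann x n) _)).
by rewrite (rnormBC (neumann x n)); lra.
Qed.

Lemma cmul_cvg (T : Type) (F : set_system T) {FF : Filter F} (u v : T -> A) x y :
  u @ F --> x -> v @ F --> y -> (fun t => u t ** v t) @ F --> x ** y.
Proof.
apply: (@bilinear_cvg _ _ _ _ (@cmul R A) 1) => [a b w|a w w'|a w].
- exact: cmulBl.
- exact: cmulBr.
- by rewrite mul1r rnorm_cmul.
Qed.

Lemma star_cvg (T : Type) (F : set_system T) {FF : Filter F} (u : T -> A) x :
  u @ F --> x -> (fun t => star (u t)) @ F --> star x.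
Proof.
move=> /cvg_rnorm_mapP ux; apply/cvg_rnorm_mapP => e /ux; apply: filterS => t.
by rewrite -starB rnorm_star.
Qed.

(** The limit [y] of the partial sums commutes with [x] and, passing to the limit in the recursion,
    satisfies [y = one + x ** y]; this makes it a two-sided inverse. *)
Lemma neumann_inverse x : rnorm x < 1 -> invertible (one - x).
Proof.
move=> x1; have [y uy] := neumann_cvg x1; exists y.
have e1 : y = one + x ** y.
  apply: (@cvg_unique _ _ (neumann x n.+1 @[n --> \oo])); first exact: norm_hausdorff.
    by have := uy; rewrite -cvg_shiftS.
  by apply: cvgD; [exact: cvg_cst|apply: cmul_cvg => //; exact: cvg_cst].
have e2 : x ** y = y ** x.
  apply: (@cvg_unique _ _ (x ** neumann x n @[n --> \oo])); first exact: norm_hausdorff.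
    apply: cmul_cvg => //; exact: cvg_cst.
  rewrite (_ : (fun n => _) = fun n => neumann x n ** x).
    by apply: cmul_cvg => //; exact: cvg_cst.
  by apply/funext => n; exact: neumann_comm.
by rewrite cmulBl cmulBr -e2 cmul1l cmul1r {1 3}e1 addrK.
Qed.

(** For larger [z], factor out [- z] and invert [one - z^-1 *: a] by the Neumann series. *)
Lemma spectrum_norm a z : spectrum a z -> rnorm z <= rnorm a.
Proof.
move=> sz; rewrite leNgt; apply/negP => az; apply: sz.
have z0 : z != 0 by apply: contraTneq az => ->; rewrite rnorm0 -leNgt rnorm_ge0.
have -> : a - z *: one = (- z) *: (one - z^-1 *: a).
  by rewrite scalerBr !scalerA mulNr mulfV// scaleNr scaleNr scale1r opprK addrC.
apply: invertibleZ; first by rewrite oppr_eq0.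
apply: neumann_inverse; rewrite rnormZ rnormV mulrC ltr_pdivrMr ?mul1r//.
by apply: le_lt_trans az; exact: rnorm_ge0.
Qed.

Lemma spectrum_shift a z w : spectrum (a + w *: one) (z + w) <-> spectrum a z.
Proof. by rewrite /spectrum/= scalerDl opprD addrACA subrr addr0. Qed.

Lemma spectrum_opp_shift a z w : spectrum (w *: one - a) (w - z) <-> spectrum a z.
Proof.
have e : w *: one - a - (w - z) *: one = - (a - z *: one).
  by rewrite scalerBl !opprB [_ - a]addrC [z *: _ - _]addrC addrA addrK addrC.
rewrite /spectrum/= e; split=> h i; apply: h; last exact: invertibleN.
by apply: invertibleN; rewrite opprK.
Qed.

(* Arens' trick: shift [a] by a large imaginary multiple of the unit. *)
Lemma spectrum_sa_real a z : sa a -> spectrum a z -> complex.Im z = 0.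
Proof.
move=> saa sz; apply/eqP/negPn/negP => y0.
have key (t : R) : complex.Re z ^+ 2 + (complex.Im z + t) ^+ 2 <= rnorm a ^+ 2 + t ^+ 2.
  have /spectrum_norm h : spectrum (a + (t%:C * 'i) *: one) (z + t%:C * 'i).
    exact/spectrum_shift.
  have {h} : rnorm (z + t%:C * 'i) ^+ 2 <= rnorm (a + (t%:C * 'i) *: one) ^+ 2.
    by rewrite ler_sqr ?nnegrE ?rnorm_ge0.
  rewrite rnorm_sqr; case: (z) => x y; simpc => /= h; apply: le_trans h _.
  rewrite -rnorm_cmul_star starD saa starZ star1.
  have -> : (t*i)^*%C = - (t*i) :> R[i] by simpc.
  rewrite scaleNr cmulBl !cmulDr !cmulZl !cmulZr cmul1l cmul1l cmul1r.
  rewrite opprD addrA addrK scalerA -scaleNr -mulrN.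
  have -> : t*i * - (t*i) = (t ^+ 2)%:C :> R[i] by rewrite expr2; simpc.
  apply: (le_trans (rnormD _ _)); rewrite rnorm_scale1 rnormC ger0_norm ?sqr_ge0//.
  by rewrite lerD2r expr2 rnorm_cmul.
(* For this [t] the cross term [2 * t * Im z] is [rnorm a ^+ 2 + 1], which already exceeds what
   [key] allows. *)
have := key ((rnorm a ^+ 2 + 1) / (2 * complex.Im z)).
set t := _ / _; have -> : (complex.Im z + t) ^+ 2 = complex.Im z ^+ 2 + (rnorm a ^+ 2 + 1) + t ^+ 2.
  by rewrite /t; field.
have := sqr_ge0 (complex.Re z); have := sqr_ge0 (complex.Im z); lra.
Qed.

End Algebra.

(** * Spectral radius of self-adjoint elements and the positive cone *)

Section SpectralRadius.
Variables (R : realType) (A : cstarAlgType R).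
Implicit Types (a b x y : A) (z w : R[i]) (r : R).
Local Notation one := (cunit : A).

Definition inverse x : A := xget 0 [set y | is_inverse x y].

Lemma inverseP x : invertible x -> is_inverse x (inverse x).
Proof. by move=> [y xy]; rewrite /inverse; case: xgetP => [? _ //|/(_ y)]. Qed.

Lemma inverse_continuous x (e : R) : invertible x -> 0 < e ->
  exists2 d : R, 0 < d & forall x', invertible x' -> rnorm (x - x') < d ->
    rnorm (inverse x - inverse x') < e.
Proof.
move=> /inverseP; set y := inverse x => -[xy yx] e0.
pose K := rnorm y + 1; have K0 : 0 < K by rewrite ltr_pwDr// rnorm_ge0.
have yK : rnorm y <= K by rewrite lerDl.
(* The first bound forces [rnorm y' <= 2 * K]; the second then makes [y' ** (x' - x) ** y] smaller
   than [e]. *)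
exists (Num.min (1 / (2 * K)) (e / (2 * K * K))).
  by rewrite lt_min !divr_gt0// !mulr_gt0.
move=> x' /inverseP; set y' := inverse x' => -[xy' yx'].
rewrite lt_min => /andP[d1 d2].
have e1 : y - y' = y' ** (x' - x) ** y.
  by rewrite cmulBr cmulBl yx' cmul1l -cmulA xy cmul1r.
have b1 : rnorm (y - y') <= rnorm y' * (rnorm (x - x') * K).
  rewrite e1 -cmulA (rnormBC x) (le_trans (rnorm_cmul _ _))//.
  rewrite ler_wpM2l ?rnorm_ge0// (le_trans (rnorm_cmul _ _))//.
  by rewrite ler_wpM2l ?rnorm_ge0.
have d1' : rnorm (x - x') * K <= 1 / 2.
  rewrite -ler_pdivlMr//; apply: ltW; apply: lt_le_trans d1 _.
  by rewrite invfM mulrA.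
have y'K : rnorm y' <= 2 * K.
  have : rnorm y' <= rnorm y' * (1 / 2) + K.
    rewrite -[y' in leLHS](subrK y) (le_trans (rnormD _ _))// lerD//.
    by rewrite rnormBC (le_trans b1)// ler_wpM2l ?rnorm_ge0.
  lra.
apply: (le_lt_trans b1).
apply: (@le_lt_trans _ _ (2 * K * (rnorm (x - x') * K))).
  by rewrite ler_wpM2r// mulr_ge0 ?rnorm_ge0// ltW.
by rewrite mulrA mulrAC mulrC -ltr_pdivlMr ?mulr_gt0.
Qed.

Fixpoint sqpow a m : A := if m is m'.+1 then sqpow a m' ** sqpow a m' else a.

Lemma sa_sqpow a m : sa a -> sa (sqpow a m).
Proof. by move=> saa; elim: m => //= m ih; rewrite /sa/= starM ih. Qed.

(** For self-adjoint elements the C*-identity says that squaring an element squares its norm. *)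
Lemma rnorm_sqpow a m : sa a -> rnorm a = 1 -> rnorm (sqpow a m) = 1.
Proof.
move=> saa a1; elim: m => //= m ih.
by rewrite -{1}(sa_sqpow m saa) rnorm_cmul_star ih expr1n.
Qed.

(** Partial fractions: the two factors of [one - z ^+ 2 *: (b ** b)] commute and their sum is
    [2 *: one]. *)
Lemma sqpow_inverse b z x y :
  is_inverse (one - z *: b) x -> is_inverse (one - (- z) *: b) y ->
  is_inverse (one - (z ^+ 2) *: (b ** b)) (2^-1 *: (x + y)).
Proof.
move=> [bx xb] [yb' by'].
have e : one - (z ^+ 2) *: (b ** b) = (one - z *: b) ** (one - (- z) *: b).
  rewrite cmulBl !cmulBr cmul1l cmul1r cmul1l cmulZl cmulZr scaleNr opprK.
  by rewrite scalerA mulrN -expr2 scaleNr opprB addrA addrAC addrK.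
have e' : one - (z ^+ 2) *: (b ** b) = (one - (- z) *: b) ** (one - z *: b).
  rewrite cmulBl !cmulBr cmul1l cmul1r cmul1l cmulZl cmulZr scaleNr.
  by rewrite scalerA mulNr -expr2 scaleNr !opprK opprD opprK addrA subrK.
have s : (one - z *: b) + (one - (- z) *: b) = 2 *: one.
  by rewrite scaleNr opprK addrACA addNr addr0 -[2]/(1 + 1) scalerDl scale1r.
have half : 2^-1 *: (2 *: one) = one by rewrite scalerA mulVf ?scale1r ?pnatr_eq0.
split.
- rewrite cmulZr cmulDr {1}e' e -!cmulA bx yb' !cmul1r addrC.
  by rewrite s.
- rewrite cmulZl cmulDl {1}e e' !cmulA xb by' !cmul1l addrC.
  by rewrite s.
Qed.

(* Rickart's approach to the spectral radius formula, for the exponents 2 ^ m only.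
   The inverse of 1 - z^2 a^(2^(m+1)) is the mean of those of 1 - z a^(2^m) and
   1 + z a^(2^m), so the modulus of continuity along rays does not deteriorate. *)
Lemma sqpow_resolvent a (e t : R) : 0 <= t <= 1 ->
  (forall z, rnorm z <= 1 -> invertible (one - z *: a)) ->
  (forall z, rnorm z = 1 ->
    rnorm (inverse (one - z *: a) - inverse (one - (t%:C * z) *: a)) <= e) ->
  forall m,
  (forall z, rnorm z <= 1 -> invertible (one - z *: sqpow a m)) /\
  (forall z, rnorm z = 1 ->
    rnorm (inverse (one - z *: sqpow a m) -
      inverse (one - ((t ^+ (2 ^ m))%:C * z) *: sqpow a m)) <= e).
Proof.
move=> t01 inva he; elim => [|m [inv ih]]; first by rewrite expr1.
have root z : exists w, w ^+ 2 = z by exists (sqrtc z); exact: sqr_sqrtc.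
have rn w : rnorm (w ^+ 2) = rnorm w ^+ 2 by rewrite !expr2 rnormM.
have step w : rnorm w <= 1 -> is_inverse (one - w ^+ 2 *: sqpow a m.+1)
    (2^-1 *: (inverse (one - w *: sqpow a m) + inverse (one - (- w) *: sqpow a m))).
  by move=> w1; apply: sqpow_inverse; apply/inverseP/inv; rewrite ?rnormN.
have stepE w : rnorm w <= 1 -> inverse (one - w ^+ 2 *: sqpow a m.+1) =
    2^-1 *: (inverse (one - w *: sqpow a m) + inverse (one - (- w) *: sqpow a m)).
  move=> w1; apply: inverse_uniq (step w w1).
  by apply: inverseP; eexists; exact: step.
split=> z z1; have [w wz] := root z; rewrite -wz rn in z1 *.
  by eexists; apply: step; rewrite -(@expr_le1 _ 2)// rnorm_ge0.
have w1 : rnorm w = 1.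
  by apply/eqP; rewrite -(@pexpr_eq1 _ _ 2)// ?rnorm_ge0//; apply/eqP.
set s := (t ^+ (2 ^ m))%:C.
have -> : (t ^+ (2 ^ m.+1))%:C * w ^+ 2 = (s * w) ^+ 2.
  by rewrite exprMn /s expnS mulnC exprM rmorphXn.
have s1 : rnorm (s * w) <= 1.
  rewrite rnormM w1 mulr1 /s rnormC ger0_norm; first by rewrite exprn_ile1; case/andP: t01.
  by rewrite exprn_ge0; case/andP: t01.
(* The difference is the mean of the differences at [w] and [- w]. Both points lie on the unit
   circle, so the induction hypothesis bounds each by [e]. *)
rewrite !stepE ?w1// -scalerBr rnormZ rnorm_half opprD addrACA.
have h1 := ih w w1; have h2 := ih (- w); rewrite rnormN in h2; have {}h2 := h2 w1.
rewrite -/s mulrN in h2; rewrite -/s in h1.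
by have := rnormD (inverse (one - w *: sqpow a m) - inverse (one - s * w *: sqpow a m))
 (inverse (one - - w *: sqpow a m) - inverse (one - - (s * w) *: sqpow a m)); lra.
Qed.

(** If inversion failed at [z != 0], the point [z^-1] of the spectrum would be real, of modulus at
    least 1 and at most [rnorm a], hence one of the two excluded points. *)
Lemma sa_resolvent_disc a : sa a -> rnorm a = 1 ->
  ~ spectrum a 1 -> ~ spectrum a (- 1) ->
  forall z, rnorm z <= 1 -> invertible (one - z *: a).
Proof.
move=> saa a1 s1 sN1 z z1; have [->|z0] := eqVneq z 0.
  by rewrite scale0r subr0; exists one; rewrite cmul1l.
have -> : one - z *: a = (- z) *: (a - z^-1 *: one).
  by rewrite scalerBr scalerA mulNr mulfV// scaleN1r opprK scaleNr addrC.
apply: invertibleZ; first by rewrite oppr_eq0.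
apply: contrapT => sz; have szV : spectrum a z^-1 by [].
have /spectrum_norm := szV; rewrite a1 => zV1.
have /(spectrum_sa_real saa) := szV; case: (z^-1) (rnormV z) szV zV1 => u v nz + + /= v0.
rewrite v0 complexr0 in nz *; move: nz; rewrite rnormC => nz szu u1.
have : `|u| = 1.
  apply/eqP; rewrite eq_le u1 nz invf_ge1// lt0r rnorm_ge0 andbT.
  by apply: contra z0 => /eqP/rnorm0_eq0 ->.
case: (ler0P u) => _ e; last by move: szu; rewrite e.
by apply: sN1; move: szu; rewrite -[u]opprK e rmorphN.
Qed.

(** Otherwise the inverses of [one - z *: a] exist on the closed disc and vary little between radius
    1 and some radius [t < 1]. The same bound holds for the power [b = sqpow a n], where the inner
    radius is close to 0 and the inverse close to [one]. Then the inverse of [one - b] is close to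
    [one] too, which forces [rnorm b < 1]. *)
Lemma spectral_radius_unit a : sa a -> rnorm a = 1 -> spectrum a 1 \/ spectrum a (- 1).
Proof.
move=> saa a1; apply: contrapT => /not_orP[s1 sN1].
have inv := sa_resolvent_disc saa a1 s1 sN1.
pose f z := inverse (one - z *: a).
have fc z (e : R) : rnorm z <= 1 -> 0 < e ->
    exists2 d : R, 0 < d & forall w, rnorm w <= 1 -> rnorm (z - w) < d -> rnorm (f z - f w) < e.
  move=> z1 e0; have [d d0 h] := inverse_continuous (inv z z1) e0.
  exists d => // w w1 zw; apply: h; first exact: inv.
  by rewrite opprB addrC addrA subrK -scalerBl rnormZ a1 mulr1 rnormBC.
(* Compactness of the disc gives one [t] for all [z]. Near each point, [w] and [t%:C * w] are both
   within [d] of it, so two continuity errors of 1/32 add up to 1/16. *)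
have [t t01 ht] : exists2 t : R, 0 <= t < 1 & forall z, rnorm z <= 1 ->
    rnorm (f z - f (t%:C * z)) <= 1 / 16.
  have /compact_near_coveringP/near_covering_withinP := @compact_disc R 1.
  move=> /(_ R ((1:R)^'-) (fun t z => rnorm (f z - f (t%:C * z)) <= 1 / 16) _) h.
  have {}h : \forall t \near (1:R)^'-, [set z | rnorm z <= 1] `<=`
      (fun z => rnorm (f z - f (t%:C * z)) <= 1 / 16).
    apply: h => z /= z1; have [//||d d0 hd] := fc z (1 / 32); first by rewrite divr_gt0.
    have d20 : 0 < d / 2 by rewrite divr_gt0.
    exists ([set z' | rnorm (z - z') < d / 2], [set t | (1 - t < d / 2) /\ 0 <= t /\ t <= 1]) => /=.
      split; first exact: (@nbhs_rnorm _ R[i]^o).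
      near=> t; split; [|split]; near: t; first exact: nbhs_left_ltBl.
        exact: nbhs_left_ge.
      exact: nbhs_left_le.
    move=> [w t] /= [zw [t1 [t0 tl1]]] w1.
    have tw1 : rnorm (t%:C * w) <= 1.
      by rewrite rnormM rnormC ger0_norm// mulr_ile1// rnorm_ge0.
    have := hd w w1; have := hd _ tw1.
    have dw : rnorm (w - t%:C * w) <= 1 - t.
      rewrite -{1}[w]mul1r -mulrBl -(rmorph1 (real_complex R)) -rmorphB rnormM rnormC.
      rewrite ger0_norm ?subr_ge0//.
      by rewrite ler_piMr// subr_ge0.
    have := rnorm_dist z w (t%:C * w) => dd h1 h2.
    have {}h1 := h1 ltac:(lra); have {}h2 := h2 ltac:(lra).
    have := rnorm_dist (f w) (f z) (f (t%:C * w)); rewrite (rnormBC (f w) (f z)); lra.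
  have := filter_ex (filterI h (filterI (nbhs_left_lt (1:R)) (nbhs_left_ge (@ltr01 R)))).
  by case=> t [ht [t1 t0]]; exists t => //; apply/andP.
have /andP[t0 t1] := t01.
have [n tn] : exists n, t ^+ n < 1 / 16 by apply: expr_small => //; rewrite divr_gt0.
have [||] := @sqpow_resolvent a (1 / 16) t _ inv _ n; first by rewrite t0 ltW.
  by move=> z z1; apply: ht; rewrite z1.
set b := sqpow a n; set s := t ^+ (2 ^ n) => invb /(_ 1 (rnorm1 _)).
have b1 : rnorm b = 1 by exact: rnorm_sqpow.
have s0 : 0 <= s by rewrite exprn_ge0.
have s16 : s < 1 / 16.
  apply: le_lt_trans tn; rewrite /s; apply: ler_wiXn2l; rewrite ?t0 ?ltW//.
  exact/ltnW/ltn_expl.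
rewrite mulr1 scale1r.
have := invb 1; rewrite rnorm1 scale1r => /(_ (lexx _))/inverseP.
have := invb s%:C; rewrite rnormC ger0_norm// => /(_ ltac:(lra))/inverseP.
set g := inverse (one - b); set fs := inverse _ => -[hf _] [hg _] gf.
have ef : fs - one = s%:C *: (b ** fs).
  by apply/eqP; rewrite subr_eq addrC -subr_eq -hf cmulBl cmul1l cmulZl.
have eg : g - one = b ** g.
  by apply/eqP; rewrite subr_eq addrC -subr_eq -hg cmulBl cmul1l.
have nf : rnorm (fs - one) <= s * rnorm fs.
  rewrite ef rnormZ rnormC ger0_norm// ler_wpM2l//.
  by rewrite (le_trans (rnorm_cmul _ _))// b1 mul1r.
have nf2 : rnorm fs <= 2.
  have : rnorm fs <= rnorm (fs - one) + 1.
    by rewrite -(rnorm_cunit A) -{1}(subrK one fs) rnormD.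
  have : s * rnorm fs <= 1 / 16 * rnorm fs by rewrite ler_wpM2r ?rnorm_ge0// ltW.
  lra.
have ng : rnorm (g - one) <= 3 / 16.
  have : s * rnorm fs <= s * 2 by rewrite ler_wpM2l.
  have := rnorm_dist g fs one; lra.
(* Since [g - one = b ** g], the element [b] is [(g - one) - b ** (g - one)], of norm at most
   6/16. *)
have : rnorm b <= rnorm (g - one) + rnorm (b ** (g - one)).
  by apply: le_trans (rnormB _ _); rewrite cmulBr -eg cmul1r opprB addrCA subrr addr0.
have := rnorm_cmul b (g - one); rewrite b1 mul1r; lra.
Unshelve. all: by end_near. Qed.

Lemma spectral_radius_sa a : sa a ->
  spectrum a (rnorm a)%:C \/ spectrum a (- (rnorm a)%:C).
Proof.
move=> saa; have [a0|a0] := eqVneq (rnorm a) 0.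
  left; rewrite a0 (rnorm0_eq0 a0) => -[y []].
  rewrite scale0r subr0 cmul0l => /esym/eqP.
  by rewrite (negbTE cunit_neq0).
have s b z w : w != 0 -> spectrum b z -> spectrum (w *: b) (w * z).
  move=> w0 sb i; apply: sb; have wV0 : w^-1 != 0 by rewrite invr_neq0.
  have := invertibleZ wV0 i.
  by rewrite scalerBr !scalerA mulrA mulVf// mul1r scale1r.
have c0 : (rnorm a)%:C != 0 :> R[i] by rewrite eq_complex/= eqxx andbT.
have e : (rnorm a)%:C *: ((rnorm a)^-1%:C *: a) = a.
  by rewrite scalerA -rmorphM/= mulfV// rmorph1 scale1r.
have [||h|h] := @spectral_radius_unit ((rnorm a)^-1%:C *: a).
- exact: saZ.
- by rewrite rnormZ rnormC ger0_norm ?invr_ge0 ?rnorm_ge0// mulVf.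
- by left; have := s _ _ _ c0 h; rewrite e mulr1.
- by right; have := s _ _ _ c0 h; rewrite e mulrN1.
Qed.

Lemma cstar_ge0_norm a r : sa a -> rnorm a <= r -> cstar_ge0 (r%:C *: one - a).
Proof.
move=> saa ar; split; first by apply: saB => //; apply/saZ/sa1.
move=> z; rewrite -[z](subKr r%:C) => /spectrum_opp_shift sz.
have := spectrum_norm sz; have := spectrum_sa_real saa sz.
move: (r%:C - z) => -[x y] /= ->; rewrite complexr0 rnormC => xr.
by rewrite -rmorphB ler0c subr_ge0 (le_trans (ler_norm _))// (le_trans xr).
Qed.

(** The spectral radius formula enters here: one of the two endpoints [rnorm a] and [- rnorm a] is
    in the spectrum, and the matching positivity hypothesis bounds it. *)
Lemma norm_cstar_ge0 a r : sa a ->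
  cstar_ge0 (r%:C *: one - a) -> cstar_ge0 (r%:C *: one + a) -> rnorm a <= r.
Proof.
move=> saa [_ h1] [_ h2]; have [s|s] := spectral_radius_sa saa.
  by have /h1 := (spectrum_opp_shift a (rnorm a)%:C r%:C).2 s; rewrite -rmorphB ler0c subr_ge0.
have := (spectrum_shift a (- (rnorm a)%:C) r%:C).2 s; rewrite [a + _]addrC => /h2.
by rewrite addrC -rmorphB ler0c subr_ge0.
Qed.

(** With its converse [dist_cstar_ge0], this replaces positivity by membership in a ball centred at
    a multiple of the unit. Spectra do not add, but norms obey the triangle inequality, so sums of
    positive elements become tractable. *)
Lemma cstar_ge0_dist a r : sa a -> rnorm (r%:C *: one - a) <= r -> cstar_ge0 a.
Proof.
move=> saa ar; rewrite -[a](subKr (r%:C *: one)).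
by apply: cstar_ge0_norm => //; apply: saB => //; apply/saZ/sa1.
Qed.

Lemma dist_cstar_ge0 a r : cstar_ge0 a -> rnorm a <= r -> rnorm (r%:C *: one - a) <= r.
Proof.
move=> [saa a0] ar; apply: norm_cstar_ge0.
- by apply: saB => //; apply/saZ/sa1.
- by rewrite subKr.
- rewrite addrA -scalerDl -rmorphD; apply: cstar_ge0_norm => //.
  have := rnorm_ge0 a; lra.
Qed.

Lemma cstar_ge0D a b : cstar_ge0 a -> cstar_ge0 b -> cstar_ge0 (a + b).
Proof.
move=> a0 b0; have [saa _] := a0; have [sab _] := b0.
apply: (@cstar_ge0_dist _ (rnorm a + rnorm b)); first exact: saD.
rewrite rmorphD scalerDl opprD addrACA; apply: (le_trans (rnormD _ _)).
by rewrite lerD// dist_cstar_ge0.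
Qed.

Lemma cstar_ge0Z r a : 0 <= r -> cstar_ge0 a -> cstar_ge0 (r%:C *: a).
Proof.
move=> r0 a0; have [saa _] := a0.
apply: (@cstar_ge0_dist _ (r * rnorm a)); first exact: saZ.
rewrite rmorphM -scalerA -scalerBr rnormZ rnormC ger0_norm//.
by rewrite ler_wpM2l// dist_cstar_ge0.
Qed.

Lemma cstar_ge0_scalar r : cstar_ge0 (r%:C *: one) <-> 0 <= r.
Proof.
split=> [[_ h]|r0].
  rewrite -ler0c; apply: h => -[y []]; rewrite subrr cmul0l => /esym/eqP.
  by rewrite (negbTE cunit_neq0).
apply: (@cstar_ge0_dist _ r); first exact/saZ/sa1.
by rewrite subrr rnorm0.
Qed.


End SpectralRadius.


(** * States *)

Section Infima.
Variable R : realType.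
Implicit Types X Y Z : set R.

Lemma inf_leD X Y Z : X !=set0 -> Y !=set0 -> has_lbound Z ->
  (forall x y, X x -> Y y -> exists2 z, Z z & z <= x + y) ->
  inf Z <= inf X + inf Y.
Proof.
move=> X0 Y0 Zl h; rewrite -lerBlDr; apply: lb_le_inf => // x Xx.
rewrite lerBlDr -lerBlDl; apply: lb_le_inf => // y Yy; rewrite lerBlDl.
by have [z Zz] := h _ _ Xx Yy; apply: le_trans; exact: ge_inf.
Qed.

Lemma inf_leM (c : R) X Z : 0 < c -> X !=set0 -> has_lbound Z ->
  (forall x, X x -> exists2 z, Z z & z <= c * x) -> inf Z <= c * inf X.
Proof.
move=> c0 X0 Zl h; rewrite mulrC -ler_pdivrMr//; apply: lb_le_inf => // x Xx.
rewrite ler_pdivrMr// mulrC.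
by have [z Zz] := h _ Xx; apply: le_trans; exact: ge_inf.
Qed.

End Infima.

(** * Hahn-Banach for real sublinear functionals, by minimality *)

Section HahnBanach.
Variables (R : realType) (V : lmodType R[i]).
Implicit Types (p q : V -> R) (x y a : V).

Record sublinear q : Prop := {
  sublinearD : forall x y, q (x + y) <= q x + q y ;
  sublinearZ : forall (r : R) x, 0 < r -> q (r%:C *: x) <= r * q x
}.

Lemma sublinear0 q : sublinear q -> q 0 = 0.
Proof.
move=> [_ qZ]; have := qZ 2 0 ltac:(lra); have := qZ (1 / 2) 0 ltac:(lra).
rewrite !scaler0; lra.
Qed.

Lemma sublinear_opp q x : sublinear q -> - q (- x) <= q x.
Proof. by move=> qs; have := sublinearD qs x (- x); rewrite subrr sublinear0//; lra. Qed.

Lemma inf_sublinear (I : Type) (J : set I) (f : I -> V -> R) :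
  J !=set0 -> (forall x, has_lbound [set f i x | i in J]) ->
  (forall i j x y, J i -> J j -> exists2 k, J k & f k (x + y) <= f i x + f j y) ->
  (forall i (r : R) x, J i -> 0 < r -> exists2 k, J k & f k (r%:C *: x) <= r * f i x) ->
  sublinear (fun x => inf [set f i x | i in J]).
Proof.
move=> [j Jj] lb fD fZ.
have ne x : [set f i x | i in J] !=set0 by exists (f j x), j.
split=> [x y|r x r0].
- apply: inf_leD => // _ _ [i Ji <-] [k Jk <-].
  by have [l Jl h] := fD i k x y Ji Jk; exists (f l (x + y)) => //; exists l.
- apply: inf_leM => // _ [i Ji <-].
  by have [l Jl h] := fZ i r x Ji r0; exists (f l (r%:C *: x)) => //; exists l.
Qed.

(* [dent q a] is the largest sublinear functional below [q] whose value at [- a]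
   is at most [- q a]. *)
Definition dent q a x : R :=
  inf [set q (x + t%:C *: a) - t * q a | t in [set t : R | 0 <= t]].

Lemma dent_lbound q a x : sublinear q ->
  has_lbound [set q (x + t%:C *: a) - t * q a | t in [set t : R | 0 <= t]].
Proof.
move=> qs; exists (- q (- x)) => _ [t t0 <-].
(* Homogeneity is assumed as an inequality; the reverse one is the same inequality for [t^-1]. *)
have ta : t * q a = q (t%:C *: a).
  move: t0; rewrite /= le_eqVlt => /predU1P[<-|t0].
    by rewrite mul0r scale0r sublinear0.
  apply/eqP; rewrite eq_le (sublinearZ qs _ t0) andbT.
  have := sublinearZ qs (t%:C *: a) (_ : 0 < t^-1).
  rewrite invr_gt0 => /(_ t0); rewrite scalerA -rmorphM mulVf ?gt_eqF// scale1r.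
  by rewrite mulrC ler_pdivlMr// mulrC.
rewrite ta; have := sublinearD qs (x + t%:C *: a) (- x).
by rewrite addrAC subrr add0r; lra.
Qed.

Lemma dent_sublinear q a : sublinear q -> sublinear (dent q a).
Proof.
move=> qs; apply: inf_sublinear.
- by exists 0 => /=.
- by move=> x; exact: dent_lbound.
- move=> s t x y /= s0 t0; exists (s + t); first by rewrite addr_ge0.
  have := sublinearD qs (x + s%:C *: a) (y + t%:C *: a).
  rewrite addrACA -scalerDl -rmorphD; lra.
- move=> s r x /= s0 r0; exists (r * s); first by rewrite mulr_ge0// ltW.
  have := sublinearZ qs (x + s%:C *: a) r0.
  rewrite scalerDr scalerA -rmorphM; lra.
Qed.

Lemma dent_le q a x (t : R) : sublinear q -> 0 <= t ->
  dent q a x <= q (x + t%:C *: a) - t * q a.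
Proof. by move=> qs t0; apply: ge_inf; [exact: dent_lbound|exists t]. Qed.

(** Zorn's lemma for the reversed pointwise order. A nonempty chain is bounded by its pointwise
    infimum, which is finite because [- p (- x) <= - q (- x) <= q x]. *)
Lemma minimal_sublinear p : sublinear p -> exists q, [/\ sublinear q,
  (forall x, q x <= p x) &
  forall q', sublinear q' -> (forall x, q' x <= q x) -> forall x, q x <= q' x].
Proof.
move=> ps; pose T := {q | sublinear q /\ forall x, q x <= p x}.
pose r (q q' : T) := `[< forall x, sval q' x <= sval q x >].
have p0 : sublinear p /\ forall x, p x <= p x by [].
have [||C Ct|q qmin] := @ZL_preorder T (exist _ p p0) r.
- by move=> q; apply/asboolP.
- move=> q1 q2 q3 /asboolP h1 /asboolP h2; apply/asboolP => x.
  exact: le_trans (h2 x) (h1 x).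
- have [[q0 Cq0]|C0] := pselect (C !=set0); last first.
    by exists (exist _ p p0) => q Cq; exfalso; apply: C0; exists q.
  have lb x : has_lbound [set sval q x | q in C].
    exists (- p (- x)) => _ [[q [qs qp]] _ <-] /=.
    by apply: le_trans (sublinear_opp x qs); rewrite lerN2.
  have ms : sublinear (fun x => inf [set sval q x | q in C]).
    apply: inf_sublinear => //; first by exists q0.
      move=> q1 q2 x y C1 C2; have [/asboolP h|/asboolP h] := Ct _ _ C1 C2.
        exists q2 => //; apply: le_trans (sublinearD (svalP q2).1 x y) _.
        by rewrite lerD2r.
      exists q1 => //; apply: le_trans (sublinearD (svalP q1).1 x y) _.
      by rewrite lerD2l.
    by move=> q s x Cq s0; exists q => //; exact: (sublinearZ (svalP q).1).
  have mp x : inf [set sval q x | q in C] <= p x.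
    apply: le_trans ((svalP q0).2 x); by apply: ge_inf => //; exists q0.
  exists (exist (fun q => sublinear q /\ forall x, q x <= p x) _ (conj ms mp)) => q Cq.
  apply/asboolP => x /=.
  by apply: ge_inf => //; exists q.
exists (sval q); split; [exact: (svalP q).1|exact: (svalP q).2|].
move=> q' q's q'q; have q'p x : q' x <= p x := le_trans (q'q x) ((svalP q).2 x).
by have /asboolP := qmin (exist _ _ (conj q's q'p)) ltac:(by apply/asboolP).
Qed.

(* A minimal sublinear functional [q] is additive: minimality gives
   [q <= dent q y], that is [q x + q y <= q (x + y)]. *)
Lemma Hahn_Banach p a : sublinear p -> exists f : V -> R,
  [/\ forall x y, f (x + y) = f x + f y, forall (r : R) x, f (r%:C *: x) = r * f x,
      forall x, f x <= p x & f a = p a].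
Proof.
(* Starting below [dent p a] instead of [p] yields [q (- a) <= - p a], whence the equality at
   [a]. *)
move=> ps; have [q [qs qp qmin]] := minimal_sublinear (dent_sublinear a ps).
have qD x y : q (x + y) = q x + q y.
  apply/eqP; rewrite eq_le (sublinearD qs)/=.
  have := qmin (dent q y) (dent_sublinear y qs).
  have h z : dent q y z <= q z.
    by have := @dent_le q y z 0 qs (lexx 0); rewrite scale0r addr0 mul0r subr0.
  move=> /(_ h x); have := @dent_le q y x 1 qs ler01; rewrite scale1r mul1r; lra.
have qN x : q (- x) = - q x.
  by have := qD x (- x); rewrite subrr (sublinear0 qs); lra.
have qp' x : q x <= p x.
  by apply: le_trans (qp x) _; have := @dent_le p a x 0 ps (lexx 0);
    rewrite scale0r addr0 mul0r subr0.
have qZ0 (r : R) x : 0 < r -> q (r%:C *: x) = r * q x.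
  move=> r0; apply/eqP; rewrite eq_le (sublinearZ qs)//=.
  by have := sublinearZ qs (- x) r0; rewrite scalerN !qN mulrN lerN2.
exists q; split => // [r x|].
  case: (ltgtP r 0) => [r0|r0|->]; last by rewrite scale0r sublinear0// mul0r.
    rewrite -[r]opprK rmorphN scaleNr qN qZ0 ?oppr_gt0//; lra.
  exact: qZ0.
apply/eqP; rewrite eq_le qp'/= -lerN2 -qN; apply: le_trans (qp _) _.
have := @dent_le p a (- a) 1 ps ler01; rewrite scale1r mul1r addNr sublinear0//; lra.
Qed.

End HahnBanach.

Section States.
Variables (R : realType) (A : cstarAlgType R).
Implicit Types (a b x y : A) (z w : R[i]) (r : R).
Local Notation one := (cunit : A).

Lemma Re_partD a b : Re_part (a + b) = Re_part a + Re_part b.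
Proof. by rewrite /Re_part starD addrACA scalerDr. Qed.

Lemma Re_partZ r a : Re_part (r%:C *: a) = r%:C *: Re_part a.
Proof. by rewrite /Re_part starZr -scalerDr !scalerA mulrC. Qed.

Lemma Re_partN a : Re_part (- a) = - Re_part a.
Proof. by rewrite /Re_part starN -opprD scalerN. Qed.

Lemma Re_part_i a : sa a -> Re_part ('i *: a) = 0.
Proof.
move=> saa; rewrite /Re_part starZ saa -scalerDl.
by rewrite (_ : 'i + _ = 0) ?scale0r ?scaler0//; simpc.
Qed.

Definition upper a : set R := [set r | cstar_ge0 (r%:C *: one - Re_part a)].

(** The top of the spectrum of the real part, written through upper bounds so that subadditivity
    reduces to sums of positive elements being positive. *)
Definition sup_spectrum a : R := inf (upper a).

Lemma upper_rnorm a : upper a (rnorm (Re_part a)).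
Proof. by apply: cstar_ge0_norm => //; exact: sa_Re. Qed.

Lemma upper_lbound a : has_lbound (upper a).
Proof.
exists (- rnorm (Re_part a)) => r /= h.
have := @cstar_ge0_norm _ _ (- Re_part a) (rnorm (Re_part a)).
rewrite rnormN => /(_ (saN (sa_Re a)) (lexx _)) => /cstar_ge0D /(_ h).
by rewrite opprK addrACA subrr addr0 -scalerDl -rmorphD => /cstar_ge0_scalar; lra.
Qed.

Lemma sup_spectrum_le a r : upper a r -> sup_spectrum a <= r.
Proof. by move=> h; apply: ge_inf => //; exact: upper_lbound. Qed.

Lemma sup_spectrum_sublinear : sublinear sup_spectrum.
Proof.
have ne a : upper a !=set0 by eexists; exact: upper_rnorm.
split=> [x y|r x r0].
- apply: inf_leD => //; first exact: upper_lbound.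
  move=> r s ur us; exists (r + s) => //=.
  by rewrite /upper/= Re_partD rmorphD scalerDl opprD addrACA; exact: cstar_ge0D.
- apply: inf_leM => //; first exact: upper_lbound.
  move=> s us; exists (r * s) => //=.
  rewrite /upper/= Re_partZ rmorphM -scalerA -scalerBr; apply: cstar_ge0Z => //.
  exact: ltW.
Qed.

Lemma norming_functional a : sa a -> exists2 b, b = a \/ b = - a & rnorm a <= sup_spectrum b.
Proof.
move=> saa.
have key b c : sa b -> spectrum b c%:C -> c <= sup_spectrum b.
  move=> sab sc; apply: lb_le_inf; first by eexists; exact: upper_rnorm.
  move=> r [_ h]; have := (spectrum_opp_shift b c%:C r%:C).2 sc.
  by rewrite -{1}(Re_part_sa sab) => /h; rewrite -rmorphB ler0c subr_ge0.
have [s|s] := spectral_radius_sa saa; first by exists a; [left|exact: key].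
exists (- a); first by right.
apply: key; first exact: saN.
have := (spectrum_opp_shift a (- (rnorm a)%:C) 0).2 s.
by rewrite scale0r !sub0r opprK.
Qed.

(** A real functional dominated by [sup_spectrum] is automatically positive and unital: it is at
    most 0 on opposites of positive elements, and its values at [one] and [- one] are at most 1 and
    -1. *)
Lemma exists_norming_state a : sa a -> exists2 phi, state_space A phi & rnorm a <= rnorm (phi a).
Proof.
move=> saa; have [b ba ab] := norming_functional saa.
have [f [fD fZ fp fb]] := Hahn_Banach b sup_spectrum_sublinear.
have fN x : f (- x) = - f x.
  by rewrite -scaleN1r -(rmorph1 (real_complex R)) -rmorphN fZ mulN1r.
(* The usual complexification of a real-linear functional. *)
pose phi x : R[i] := f x +i* (- f ('i *: x)).
(* The real parts of ['i *: x] and of its opposite are 0, so domination by [sup_spectrum] leaves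
   only the value 0. Thus [phi] is real on self-adjoint elements. *)
have fi x : sa x -> f ('i *: x) = 0.
  have h y : sa y -> f ('i *: y) <= 0.
    move=> say; apply: le_trans (fp _) _; apply: sup_spectrum_le.
    by rewrite /upper/= Re_part_i// subr0; exact/cstar_ge0_scalar.
  move=> sax; apply/eqP; rewrite eq_le h//=.
  by have := h _ (saN sax); rewrite scalerN fN oppr_le0.
have phiD x y : phi (x + y) = phi x + phi y.
  by rewrite /phi scalerDr !fD opprD; simpc.
have phiZr r x : phi (r%:C *: x) = r%:C * phi x.
  by rewrite /phi scalerA ['i * _]mulrC -scalerA !fZ -mulrN; simpc.
have phiZi x : phi ('i *: x) = 'i * phi x.
  rewrite /phi scalerA (_ : 'i * 'i = -1); last by rewrite -expr2 sqr_i.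
  by rewrite scaleN1r fN opprK; simpc.
exists phi; last first.
  apply: le_trans ab _; rewrite -fb; apply: le_trans (ge_Re_rnorm (phi a)).
  by case: ba => ->; rewrite ?fN ?ler_norm// -normrN ler_norm.
split.
- move=> z x y; rewrite phiD; congr (_ + _).
  by rewrite {1}(complexE z) scalerDl phiD -scalerA phiZr phiZi phiZr mulrA -mulrDl -complexE.
- move=> x x0; have [sax _] := x0; rewrite /phi fi// oppr0 complexr0 ler0c.
  rewrite -oppr_le0 -fN; apply: le_trans (fp _) _; apply: sup_spectrum_le.
  by rewrite /upper/= Re_partN opprK Re_part_sa// scale0r add0r.
- rewrite /phi fi ?oppr0; last exact: sa1.
  have h r : f (r%:C *: one) <= r.
    apply: le_trans (fp _) _; apply: sup_spectrum_le.
    rewrite /upper/= Re_part_sa ?subrr; last exact/saZ/sa1.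
    by have := (@cstar_ge0_scalar _ A 0).2 (lexx _); rewrite scale0r.
  have h1 := h 1; rewrite rmorph1 scale1r in h1.
  have := h (- 1); rewrite fZ mulN1r lerN2 => h2.
  by congr (_ +i* _); apply/eqP; rewrite eq_le h1 h2.
Qed.

Lemma state_space_nonempty : exists phi, state_space A phi.
Proof. by have [phi ? _] := exists_norming_state (sa0 A); exists phi. Qed.

Lemma state_scale phi z a : state_space A phi -> phi (z *: a) = z * phi a.
Proof.
move=> [lin _ _]; have := lin z a 0; have := lin 1 0 0.
rewrite scaler0 !addr0 mul1r => /eqP; rewrite -subr_eq0 opprD addrA subrr sub0r oppr_eq0.
by move=> /eqP -> ->; rewrite addr0.
Qed.

Lemma stateD phi a b : state_space A phi -> phi (a + b) = phi a + phi b.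
Proof. by move=> [lin _ _]; rewrite -{1}[a]scale1r lin mul1r. Qed.

Lemma stateB phi a b : state_space A phi -> phi (a - b) = phi a - phi b.
Proof. by move=> s; rewrite stateD// -scaleN1r state_scale// mulN1r. Qed.

(** Evaluate the state on the positive elements [rnorm a] plus and minus [a]; the partial order of
    [R[i]] also makes [phi a] real. *)
Lemma state_sa_le phi a : state_space A phi -> sa a -> rnorm (phi a) <= rnorm a.
Proof.
move=> s saa; have [_ pos phi1] := s.
have := pos _ (cstar_ge0_norm saa (lexx _)).
have := pos _ (cstar_ge0_norm (saN saa) (_ : rnorm (- a) <= rnorm a)).
rewrite rnormN => /(_ (lexx _)); rewrite opprK stateD// stateB// state_scale// phi1 mulr1.
case: (phi a) => u v; rewrite !lecE /= => /andP[/eqP v0 h1] /andP[_ h2].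
have -> : v = 0 by lra.
rewrite complexr0 rnormC ler_norml; apply/andP; split; lra.
Qed.

Lemma state_le phi a : state_space A phi -> rnorm (phi a) <= 2 * rnorm a.
Proof.
move=> s; rewrite {1}(Re_Im_part a) stateD// (state_scale 'i)//.
apply: (le_trans (rnormD _ _)); rewrite rnormM rnorm_i mul1r.
have := state_sa_le s (sa_Re a); have := state_sa_le s (sa_Im a).
have := rnorm_Re_part a; have := rnorm_Im_part a; lra.
Qed.

End States.


(** * Weak-star compactness of the state space *)

Section StateSpace.
Variables (R : realType) (A : cstarAlgType R).
Implicit Types (a b x y : A) (z w : R[i]) (r : R).
Local Notation one := (cunit : A).

Lemma cvg_ge0C (T : Type) (F : set_system T) {FF : ProperFilter F} (u : T -> R[i]) (l : R[i]) :
  (u : T -> R[i]^o) @ F --> (l : R[i]^o) -> (\forall t \near F, 0 <= u t) -> 0 <= l.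
Proof.
move=> /cvg_rnorm_mapP ul u0.
have h (e : R) : 0 < e -> exists2 x : R, 0 <= x & rnorm (l - x%:C) < e.
  move=> e0; have [t [lt t0]] := filter_ex (filterI (ul _ e0) u0).
  exists (complex.Re (u t)); last by rewrite RRe_real// ger0_real.
  by rewrite -ler0c RRe_real// ger0_real.
rewrite lecE/=; apply/andP; split.
- rewrite -normr_le0; apply/ler_addgt0Pr => e /h[x x0].
  have := ge_Im_rnorm (l - x%:C); case: (l) => u1 v /=; rewrite oppr0 addr0 add0r.
  by move=> h1 h2; apply: le_trans h1 (ltW h2).

- apply/ler_addgt0Pr => e /h[x x0]; have := ge_Re_rnorm (l - x%:C).
  case: (l) => u1 v /=; rewrite ler_norml => /andP[]; lra.
Qed.

(** The values at each [a] are bounded by [2 * rnorm a], hence converge along [G], and the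
    conditions defining a state are closed under pointwise limits. *)
Lemma state_ultra_limit (G : set_system (A -> R[i])) : UltraFilter G ->
  G (state_space A) -> exists2 phi, state_space A phi &
    forall a, (fun psi : A -> R[i] => psi a : R[i]^o) @ G --> (phi a : R[i]^o).
Proof.
move=> GU GS; have GF : ProperFilter G by exact: ultra_proper.
have /choice[phi phiP] : forall a, exists l : R[i],
    (fun psi : A -> R[i] => psi a : R[i]^o) @ G --> (l : R[i]^o).
  move=> a; apply: (@ultra_bounded_cvgC _ _ G (fun psi => psi a) (2 * rnorm a)) => //.
  by apply: filterS GS => psi; exact: state_le.
exists phi => //; split.
- move=> z a b; apply: (@cvg_rnorm_unique _ R[i]^o _ G _ (fun psi : A -> R[i] => psi (z *: a + b))).
  + exact: phiP.
  + have : (fun psi : A -> R[i] => z *: (psi a : R[i]^o) + psi b) @ G -->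
        (z * phi a + phi b : R[i]^o).
      by apply: cvgD => //; exact: cvgZr.
    apply: cvg_trans; apply: near_eq_cvg; apply: filterS GS => psi [lin _ _].
    by rewrite lin.
- move=> a a0; apply: (cvg_ge0C (phiP a)); apply: filterS GS => psi [_ + _].
  exact.
- apply: (@cvg_rnorm_unique _ R[i]^o _ G _ (fun psi : A -> R[i] => psi one)).
  + exact: phiP.
  + have : (fun psi : A -> R[i] => 1 : R[i]^o) @ G --> (1 : R[i]^o) by exact: cvg_cst.
    by apply: cvg_trans; apply: near_eq_cvg; apply: filterS GS => psi [_ _ ->].
Qed.

Lemma compact_states : compact (state_space A : set {ptws A -> R[i]^o}).
Proof.
rewrite compact_ultra => G GU GS; have [phi Sphi phiP] := state_ultra_limit GU GS.
exists phi; split => //.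
have GF : ProperFilter G by exact: ultra_proper.
exact/pointwise_cvgP.
Qed.

End StateSpace.

(** * The Monge-Kantorovich metric and compactness of Lipschitz balls *)

Section Lipschitz.
Variables (R : realType) (F : R -> R -> R -> R -> R) (A : cstarAlgType R).
Variables (L : A -> \bar R) (PL : is_qcms F L).
Implicit Types (a b x y : A) (z w : R[i]) (r l : R) (phi psi : A -> R[i]).
Local Notation one := (cunit : A).

Lemma L_sa a l : (L a <= l%:E)%E -> sa a.
Proof. by move=> al; apply: (jl_sa (L_dom PL)); apply: le_lt_trans al (ltry _). Qed.

Lemma L_dom_le a l : (L a <= l%:E)%E -> ldom L a.
Proof. by move=> al; apply: le_lt_trans al (ltry _). Qed.

Lemma L_0 : L 0 = 0%E.
Proof. by apply/(L_eq0 PL); exists 0; rewrite scale0r. Qed.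

Lemma L_scale_le a r l : (L a <= l%:E)%E -> (L (r%:C *: a) <= (`|r| * l)%:E)%E.
Proof.
move=> al; rewrite (L_Z PL)//; last exact: L_dom_le al.
by rewrite EFinM lee_wpmul2l.
Qed.

Lemma L_add_le a b l l' : (L a <= l%:E)%E -> (L b <= l'%:E)%E ->
  (L (a + b)%R <= (l + l')%:E)%E.
Proof.
move=> al bl; apply: le_trans (L_D PL (L_dom_le al) (L_dom_le bl)) _.
by rewrite EFinD leeD.
Qed.

Lemma mk_ge0 phi psi : (0 <= mk L phi psi)%E.
Proof.
apply: (@le_trans _ _ (rnorm (phi 0 - psi 0))%:E); first by rewrite lee_fin rnorm_ge0.
by apply: ereal_sup_ubound; exists 0 => //=; rewrite L_0 lee01.
Qed.

Lemma mk_refl phi : mk L phi phi = 0%E.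
Proof.
apply/eqP; rewrite eq_le mk_ge0 andbT; apply: ge_ereal_sup => _ [a _ <-].
by rewrite subrr rnorm0.
Qed.

Lemma mk_triangle phi psi xi : (mk L phi xi <= mk L phi psi + mk L psi xi)%E.
Proof.
apply: ge_ereal_sup => _ [a La <-].
apply: (@le_trans _ _ ((rnorm (phi a - psi a))%:E + (rnorm (psi a - xi a))%:E)%E).
  by rewrite -EFinD lee_fin rnorm_dist.
by apply: leeD; apply: ereal_sup_ubound; exists a.
Qed.

Lemma mk_dist_lt phi psi a (l e : R) : state_space A phi -> state_space A psi ->
  0 < l -> (L a <= l%:E)%E -> (mk L phi psi < e%:E)%E ->
  rnorm (phi a - psi a) < l * e.
Proof.
move=> sphi spsi l0 al h.
have : ((rnorm (phi (l^-1%:C *: a) - psi (l^-1%:C *: a)))%:E < e%:E)%E.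
  apply: le_lt_trans h; apply: ereal_sup_ubound; exists (l^-1%:C *: a) => //=.
  apply: le_trans (L_scale_le l^-1 al) _.
  by rewrite ger0_norm ?invr_ge0 ?(ltW l0)// mulVf// (gt_eqF l0).
rewrite lte_fin !state_scale// -mulrBr rnormM rnormC ger0_norm ?invr_ge0 ?ltW//.
by rewrite mulrC ltr_pdivrMr// mulrC.
Qed.

Lemma mk_near phi (e : R) : state_space A phi -> 0 < e ->
  \forall psi \near (phi : {ptws A -> R[i]^o}), state_space A psi -> (mk L phi psi < e%:E)%E.
Proof.
move=> sphi e0; have [_ h] := L_mk PL.
by apply/(h phi [set psi | (mk L phi psi < e%:E)%E] sphi); exists e.
Qed.

(** Balls of [mk L] are weak-star neighbourhoods, so the finite function [mk L phi0] is locally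
    bounded, hence bounded on the compact state space. Finiteness of extents relies on this. *)
Lemma mk_bounded : exists2 M : R, 0 < M & forall phi psi,
  state_space A phi -> state_space A psi -> (mk L phi psi <= M%:E)%E.
Proof.
have [phi0 s0] := state_space_nonempty A.
have [fin _] := L_mk PL.
have sym phi psi : mk L phi psi = mk L psi phi.
  by rewrite /mk; congr ereal_sup; apply: eq_imagel => a _; rewrite rnormBC.
have /compact_near_coveringP/near_covering_withinP := @compact_states R A.
move=> /(_ R +oo (fun M phi => (mk L phi0 phi <= M%:E)%E) _) h.
have {h} : \forall M \near +oo, state_space A `<=` (fun phi => (mk L phi0 phi <= M%:E)%E).
  apply: h => phi sphi.
  have /andP[m0 moo] := fin _ _ s0 sphi.
  have mE : mk L phi0 phi = (fine (mk L phi0 phi))%:E by rewrite fineK// ge0_fin_numE.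
  set m := fine _ in mE.
  exists ([set psi | state_space A psi -> (mk L phi psi < 1%:E)%E], [set M | m + 1 <= M]) => /=.
    by split; [exact: mk_near|exact/nbhs_pinfty_ge/num_real].
  move=> [psi M] /= [h1 h2] /h1 {}h1; apply: le_trans (mk_triangle phi0 phi psi) _.
  rewrite mE; apply: (@le_trans _ _ (m + 1)%:E); last by rewrite lee_fin.
  by rewrite EFinD leeD// ltW.
move=> hM; have [M [h1 M0]] := filter_ex (filterI hM (nbhs_pinfty_gt (num_real (0 : R)))).
exists (M + M); first by rewrite addr_gt0.
move=> phi psi /h1 hphi /h1 hpsi; apply: le_trans (mk_triangle phi phi0 psi) _.
by rewrite EFinD leeD// sym.
Qed.

(* Pointwise convergence on states is uniform, because the states form a compact set
   covered by balls of [mk L], on which the elements of the Lipschitz ball are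
   equicontinuous. *)
Lemma Lip_ball_cvg (T : Type) (U : set_system T) (u : T -> A) (l K : R) :
  UltraFilter U -> (\forall t \near U, (L (u t) <= l%:E)%E /\ rnorm (u t) <= K) ->
  exists2 a, u @ U --> a & (L a <= l%:E)%E.
Proof.
move=> UU uP; have UF : ProperFilter U by exact: ultra_proper.
pose l' := `|l| + 1; have l'0 : 0 < l' by rewrite ltr_pwDr// normr_ge0.
have ll' : l <= l' by have := ler_norm l; rewrite /l'; lra.
suff [a ua] : exists a, u @ U --> a.
  exists a => //; rewrite leNgt; apply/negP => /(L_lsc PL)[V Va LV].
  have UV : U (u @^-1` V) by exact: ua.
  have [t [/LV]] := filter_ex (filterI UV uP).
  by rewrite ltNge => /negP + [].
apply: cauchy_rnorm => e e0.
(* The parameter is a pair of indices: the covering argument turns the Cauchy property at each state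
   into one that is uniform over all states. *)
have /compact_near_coveringP/near_covering_withinP := @compact_states R A.
move=> /(_ (T * T)%type (filter_prod U U) (fun st phi =>
  [/\ (L (u st.1) <= l%:E)%E, (L (u st.2) <= l%:E)%E &
   rnorm (phi (u st.1) - phi (u st.2)) <= e / 2]) _) h.
have [phi sphi|[P Q] [/= UP UQ] PQ] := h.
  have [|z uz] := @ultra_bounded_cvgC _ _ U (fun t => phi (u t)) (2 * K) => //.
    apply: filterS uP => t [_ tK]; apply: le_trans (state_le _ sphi) _.
    by rewrite ler_wpM2l.
  (* Four errors of this size are added below: two for passing between [psi] and [phi], two for the
     convergence at [phi]. *)
  have e8 : 0 < e / 16 by rewrite divr_gt0.
  have /cvg_rnorm_mapP/(_ _ e8) uze := uz.
  have e8l : 0 < e / 16 / l' by rewrite divr_gt0.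
  pose W := [set t | rnorm (z - phi (u t)) < e / 16 /\ ((L (u t) <= l%:E)%E /\ rnorm (u t) <= K)].
  have UW : U W by exact: filterI.
  exists ([set psi | state_space A psi -> (mk L phi psi < (e / 16 / l')%:E)%E], W `*` W) => /=.
    by split; [exact: mk_near|exists (W, W)].
  move=> [psi [s t]] /= [hpsi [[Ws [Ls _]] [Wt [Lt _]]]] spsi.
  split => //.
  have {}hpsi := hpsi spsi.
  have L' v : (L v <= l%:E)%E -> (L v <= l'%:E)%E by move/le_trans; apply; rewrite lee_fin.
  have := mk_dist_lt sphi spsi l'0 (L' _ Ls) hpsi.
  have := mk_dist_lt sphi spsi l'0 (L' _ Lt) hpsi.
  rewrite mulrCA mulfV ?gt_eqF// mulr1 => h1 h2.
  have := rnorm_dist (psi (u s)) (phi (u s)) (psi (u t)).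
  have := rnorm_dist (phi (u s)) (phi (u t)) (psi (u t)).
  have := rnorm_dist (phi (u s)) z (phi (u t)).
  rewrite (rnormBC (psi (u s)) (phi (u s))) (rnormBC (phi (u s)) z); lra.
exists (u @` (P `&` Q)).
  by apply: filterS (filterI UP UQ) => t PQt; exists t.
move=> _ _ [s [Ps Qs] <-] [t [Pt Qt] <-].
have st : P s /\ Q t by [].
(* A bound at all states is a norm bound, since [u s - u t] is self-adjoint. *)
have [|phi sphi] := @exists_norming_state _ A (u s - u t).
  have [phi0 s0] := state_space_nonempty A.
  by have [/L_sa ? /L_sa ? _] := PQ (s, t) st phi0 s0; exact: saB.
have [_ _] := PQ (s, t) st phi sphi; rewrite /= stateB//; lra.
Qed.

End Lipschitz.


(** * Morphisms and Hilbert modules *)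

Section Morphisms.
Variables (R : realType) (A B : cstarAlgType R) (pi : star_morphism A B).
Implicit Types (a : A) (z : R[i]) (r : R).

Lemma smap_invertible a : invertible a -> invertible (pi a).
Proof. by move=> [b [ab ba]]; exists (pi b); rewrite -!smapM ab ba smap1. Qed.

Lemma smap_spectrum a z : spectrum (pi a) z -> spectrum a z.
Proof.
move=> h i; apply: h; rewrite -(smap1 pi) -linearZ -linearB.
exact: smap_invertible.
Qed.

Lemma smap_sa a : sa a -> sa (pi a).
Proof. by rewrite /sa/= -smap_star => ->. Qed.

Lemma smap_ge0 a : cstar_ge0 a -> cstar_ge0 (pi a).
Proof.
by move=> [saa a0]; split=> [|z /smap_spectrum]; [exact: smap_sa|exact: a0].
Qed.

Lemma smap_rnorm_sa a : sa a -> rnorm (pi a) <= rnorm a.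
Proof.
move=> saa; apply: norm_cstar_ge0; first exact: smap_sa.
- by rewrite -(smap1 pi) -linearZ -linearB; exact/smap_ge0/cstar_ge0_norm.
- rewrite -(smap1 pi) -linearZ -linearD; apply: smap_ge0; rewrite -[a in _ + a]opprK.
  by apply: cstar_ge0_norm; [exact: saN|rewrite rnormN].
Qed.

(** The C*-identity reduces the claim to the self-adjoint element [star a ** a]. *)
Lemma smap_rnorm a : rnorm (pi a) <= rnorm a.
Proof.
rewrite -(@ler_pXn2r _ 2) ?nnegrE ?rnorm_ge0// -!rnorm_cmul_star -smap_star -smapM.
by apply: smap_rnorm_sa; rewrite /sa/= starM starK.
Qed.

Lemma smap_Re a : pi (Re_part a) = Re_part (pi a).
Proof. by rewrite /Re_part linearZ/= linearD smap_star. Qed.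

Lemma smap_Im a : pi (Im_part a) = Im_part (pi a).
Proof. by rewrite /Im_part linearZ/= linearB smap_star. Qed.

Lemma state_pullback phi : state_space B phi -> state_space A (fun a => phi (pi a)).
Proof.
move=> [lin pos phi1]; split=> [z x y|a /smap_ge0/pos//|]; last by rewrite smap1.
by rewrite linearP lin.
Qed.

Lemma smap_inverse g : cancel pi g -> cancel g pi ->
  exists h : star_morphism B A, forall b, h b = g b.
Proof.
move=> piK gK.
have glin : linear g.
  by move=> z x y; apply: (can_inj piK); rewrite linearP !gK.
pose gL : {linear B -> A} := HB.pack g (GRing.isLinear.Build R[i] B A *:%R g glin).
have g1 : gL cunit = cunit by apply: (can_inj piK); rewrite gK smap1.
have gM x y : gL (x ** y) = gL x ** gL y.
  by apply: (can_inj piK); rewrite smapM !gK.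
have gS x : gL (star x) = star (gL x).
  by apply: (can_inj piK); rewrite smap_star !gK.
by exists (StarMorphism g1 gM gS).
Qed.

(** This makes the extent of the tunnel of a full isometry vanish: the pulled back states fill the
    state space. *)
Lemma state_pullback_bij : bijective pi ->
  [set (fun a => phi (pi a)) | phi in state_space B] = state_space A.
Proof.
move=> [g piK gK]; apply/seteqP; split=> [_ [phi sphi <-]|psi spsi].
  exact: state_pullback.
have [h hg] := smap_inverse piK gK.
exists (fun b => psi (g b)); last by apply/funext => a; rewrite piK.
suff -> : (fun b => psi (g b)) = fun b => psi (h b).
  move: spsi => [lin pos psi1]; split=> [z x y||].
  - by rewrite linearP lin.
  - move=> b [sab b0]; apply: pos; split.
      by rewrite /sa/= -smap_star sab.
    move=> z; have := b0 z => hz sz; apply: hz => -[y [h1 h2]]; apply: sz.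
    by exists (h y); rewrite -(smap1 h) -linearZ -linearB -!smapM h1 h2.
  - by rewrite smap1.
by apply/funext => b; rewrite hg.
Qed.

End Morphisms.

Section ComplexLipschitz.
Variables (R : realType) (A : cstarAlgType R).
Implicit Types (a b x y : A) (z w : R[i]) (r : R).

Lemma Im_partD a b : Im_part (a + b) = Im_part a + Im_part b.
Proof. by rewrite /Im_part starD opprD addrACA scalerDr. Qed.

Lemma Im_partN a : Im_part (- a) = - Im_part a.
Proof. by rewrite /Im_part starN -opprD scalerN. Qed.

Lemma Im_partZ r a : Im_part (r%:C *: a) = r%:C *: Im_part a.
Proof. by rewrite /Im_part starZr -scalerBr !scalerA mulrC. Qed.

Lemma Im_part_i a : Im_part ('i *: a) = Re_part a.
Proof.
rewrite /Im_part /Re_part starZ.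
have -> : 'i%C^*%C = - 'i%C :> R[i] by simpc.
rewrite scaleNr opprK -scalerDr scalerA invfM -mulrA mulVf ?mulr1//.
by rewrite eq_complex/= oner_eq0 andbF.
Qed.

Lemma Re_part_iE a : Re_part ('i *: a) = - Im_part a.
Proof.
rewrite {2}(_ : a = - ('i *: ('i *: a))).
  by rewrite Im_partN Im_part_i opprK.
by rewrite scalerA -expr2 sqr_i scaleN1r opprK.
Qed.

Lemma Im_part_sa a : sa a -> Im_part a = 0.
Proof. by rewrite /sa/= /Im_part => ->; rewrite subrr scaler0. Qed.

Lemma Re_part_star a : Re_part (star a) = Re_part a.
Proof. by rewrite /Re_part starK addrC. Qed.

Lemma Im_part_star a : Im_part (star a) = - Im_part a.
Proof. by rewrite /Im_part starK -scalerN opprB. Qed.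

Variables (F : R -> R -> R -> R -> R) (L : A -> \bar R) (PL : is_qcms F L).

(* [clipschitz l a] bounds the Lipschitz seminorms of the real and imaginary parts
   of an arbitrary element. *)
Definition clipschitz (l : R) a := (L (Re_part a) <= l%:E)%E /\ (L (Im_part a) <= l%:E)%E.

Lemma L_opp_le a l : (L a <= l%:E)%E -> (L (- a)%R <= l%:E)%E.
Proof.
move=> /(L_scale_le PL (- 1)); rewrite normrN1 mul1r.
by rewrite rmorphN rmorph1 scaleN1r.
Qed.

Lemma L_le_ge0 a l : (L a <= l%:E)%E -> 0 <= l.
Proof. by move=> h; rewrite -lee_fin; apply: le_trans h; exact: (L_ge0 PL). Qed.

Lemma clipschitzD a b l l' : clipschitz l a -> clipschitz l' b -> clipschitz (l + l') (a + b).
Proof.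
by move=> [h1 h2] [h3 h4]; split; rewrite ?Re_partD ?Im_partD; exact: (L_add_le PL).
Qed.

Lemma clipschitzZr a r l : clipschitz l a -> clipschitz (`|r| * l) (r%:C *: a).
Proof.
by move=> [h1 h2]; split; rewrite ?Re_partZ ?Im_partZ; exact: (L_scale_le PL).
Qed.

Lemma clipschitz_i a l : clipschitz l a -> clipschitz l ('i *: a).
Proof.
by move=> [h1 h2]; split; rewrite ?Im_part_i ?Re_part_iE//; exact: L_opp_le.
Qed.

Lemma clipschitzZ a z l : clipschitz l a ->
  clipschitz (`|complex.Re z| * l + `|complex.Im z| * l) (z *: a).
Proof.
move=> la; rewrite (complexE z) scalerDl -scalerA.
apply: clipschitzD; last apply: clipschitz_i.
  by rewrite -complexE; exact: clipschitzZr.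
by rewrite -complexE; exact: clipschitzZr.
Qed.

Lemma clipschitz_star a l : clipschitz l a -> clipschitz l (star a).
Proof.
by move=> [h1 h2]; split; rewrite ?Re_part_star ?Im_part_star//; exact: L_opp_le.
Qed.

Lemma clipschitz_cunit : clipschitz 0 cunit.
Proof.
split; first by rewrite Re_part_sa ?(L_eq0 PL _).2//; [exists 1; rewrite scale1r|exact: sa1].
by rewrite Im_part_sa ?(L_0 PL)//; exact: sa1.
Qed.

Lemma clipschitz_sa a l : (L a <= l%:E)%E -> clipschitz l a.
Proof.
move=> al; have saa := L_sa PL al; split; first by rewrite Re_part_sa.
by rewrite Im_part_sa// (L_0 PL) lee_fin (L_le_ge0 al).
Qed.

Hypothesis pF : permissible F.

Lemma clipschitz_cmul_sa a b (K l l' : R) : (L a <= l%:E)%E -> (L b <= l'%:E)%E ->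
  rnorm a <= K -> rnorm b <= K -> clipschitz (F K K l l') (a ** b).
Proof.
move=> al bl aK bK; have [Fmono _] := pF.
have : (maxe (L (Re_part (a ** b)%R)) (L (Im_part (a ** b)%R)) <= (F K K l l')%:E)%E.
  apply: le_trans (L_Leibniz PL (L_dom_le al) (L_dom_le bl)) _; rewrite lee_fin.
  have h c m : (L c <= m%:E)%E -> 0 <= fine (L c) <= m.
    move=> cm; rewrite fine_ge0 ?(L_ge0 PL)//=.
    rewrite -lee_fin fineK// ge0_fin_numE ?(L_ge0 PL)//.
    exact: le_lt_trans cm (ltry _).
  by apply: Fmono; rewrite ?rnorm_ge0 ?h.
by rewrite ge_max => /andP[].
Qed.

(** Splitting both factors into real and imaginary parts leaves four products of self-adjoint
    elements, one Leibniz bound for each. *)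
Lemma clipschitz_cmul a b (K l : R) : clipschitz l a -> clipschitz l b ->
  rnorm a <= K -> rnorm b <= K ->
  clipschitz (F K K l l + F K K l l + (F K K l l + F K K l l)) (a ** b).
Proof.
move=> [a1 a2] [b1 b2] aK bK.
rewrite {1}(Re_Im_part a) {1}(Re_Im_part b) cmulDr !cmulDl.
have h (c : A) : rnorm c <= K -> rnorm (Re_part c) <= K /\ rnorm (Im_part c) <= K.
  by move=> cK; split; apply: le_trans cK; [exact: rnorm_Re_part|exact: rnorm_Im_part].
have [a1K a2K] := h _ aK; have [b1K b2K] := h _ bK.
rewrite !(cmulZl 'i) !(cmulZr 'i).
apply: clipschitzD; apply: clipschitzD; do ?apply: clipschitz_i; exact: clipschitz_cmul_sa.
Qed.

End ComplexLipschitz.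

Section HilbertModule.
Variables (R : realType) (A : cstarAlgType R) (M : hilbertModType A).
Implicit Types (w v : M).

Lemma rnorm_inner_sqr w : rnorm (inner w w) = rnorm w ^+ 2.
Proof. by rewrite hilbert_norm sqr_sqrtr// rnorm_ge0. Qed.

Lemma inner0l w : inner 0 w = 0.
Proof. by rewrite -(scale0r (0 : M)) innerZl scale0r. Qed.

Lemma inner0r w : inner w 0 = 0.
Proof. by rewrite -(scale0r (0 : M)) innerZr rmorph0 scale0r. Qed.

Lemma innerBl w v u : inner (w - v) u = inner w u - inner v u.
Proof. by rewrite innerDl -scaleN1r innerZl scaleN1r. Qed.

Lemma innerBr w v u : inner u (w - v) = inner u w - inner u v.
Proof. by rewrite innerDr -scaleN1r innerZr rmorphN rmorph1 scaleN1r. Qed.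

Lemma polarization w v : 2 *: inner w v =
  (inner (w + v) (w + v) - inner w w - inner v v) +
  'i *: (inner (w + 'i *: v) (w + 'i *: v) - inner w w - inner v v).
Proof.
have ii : 'i * 'i = -1 :> R[i] by rewrite -expr2 sqr_i.
have iJ : 'i%C^*%C = - 'i%C :> R[i] by simpc.
have e (s x y t : A) : s + x + (y + t) - s - t = x + y.
  by rewrite (addrC s x) addrACA -[_ - s - t]addrA -opprD addrK.
rewrite !innerDl !innerDr !innerZl !innerZr iJ !scalerA mulrN ii opprK scale1r.
rewrite !e// scalerDr !scalerA mulrN ii opprK scale1r scaleN1r.
by rewrite addrACA subrr addr0 -[2]/(1 + 1) scalerDl scale1r.
Qed.

(** Polarization takes the place of Cauchy-Schwarz, as the constant only serves continuity: each of
    the two brackets has norm at most 4 + 1 + 1, and their sum is twice the inner product. *)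
Lemma rnorm_inner_unit w v : rnorm w <= 1 -> rnorm v <= 1 -> rnorm (inner w v) <= 6.
Proof.
move=> w1 v1; have q (u : M) (c : R) : rnorm u <= c -> rnorm (inner u u) <= c ^+ 2.
  move=> uc; rewrite rnorm_inner_sqr ler_pXn2r ?nnegrE ?rnorm_ge0//.
  by apply: le_trans uc; exact: rnorm_ge0.
have h u : rnorm u <= 1 -> rnorm (inner (w + u) (w + u) - inner w w - inner v v) <= 6.
  move=> u1; have /q : rnorm (w + u) <= 2 by have := rnormD w u; lra.
  have := q _ _ w1; have := q _ _ v1; rewrite expr1n.
  have := rnormB (inner (w + u) (w + u) - inner w w) (inner v v).
  have := rnormB (inner (w + u) (w + u)) (inner w w); lra.
have h1 := h v v1; have := h ('i *: v); rewrite rnormZ rnorm_i mul1r => /(_ v1) h2.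
have : rnorm (2 *: inner w v) <= 12.
  rewrite polarization (le_trans (rnormD _ _))// rnormZ rnorm_i mul1r; lra.
by rewrite rnormZ -(rmorph_nat (real_complex R)) rnormC ger0_norm//; lra.
Qed.

Lemma rnorm_inner w v : rnorm (inner w v) <= 6 * rnorm w * rnorm v.
Proof.
have [w0|w0] := eqVneq (rnorm w) 0.
  by rewrite (rnorm0_eq0 w0) inner0l !rnorm0 mulr0 mul0r.
have [v0|v0] := eqVneq (rnorm v) 0.
  by rewrite (rnorm0_eq0 v0) inner0r !rnorm0 mulr0.
have p (V : normedModType R[i]) (u : V) : rnorm u != 0 -> 0 < rnorm u.
  by move=> u0; rewrite lt_neqAle eq_sym u0 rnorm_ge0.
have n (V : normedModType R[i]) (u : V) : rnorm u != 0 -> rnorm ((rnorm u)^-1%:C *: u) <= 1.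
  by move=> u0; rewrite rnormZ rnormC ger0_norm ?invr_ge0 ?rnorm_ge0// mulVf.
have := rnorm_inner_unit (n _ _ w0) (n _ _ v0).
rewrite innerZl innerZr conjc_real !rnormZ !rnormC !ger0_norm ?invr_ge0 ?rnorm_ge0//.
by rewrite mulrA -invfM mulrC ler_pdivrMr ?mulr_gt0 ?p// mulrA.
Qed.

Lemma inner_cvg (T : Type) (F : set_system T) {FF : Filter F} (u v : T -> M) w1 w2 :
  u @ F --> w1 -> v @ F --> w2 -> (fun t => inner (u t) (v t)) @ F --> inner w1 w2.
Proof.
apply: (@bilinear_cvg _ _ _ _ (@inner R A M) 6) => [a b w|a w w'|a w].
- exact: innerBl.
- exact: innerBr.
- exact: rnorm_inner.
Qed.

End HilbertModule.


(** * Extension of bounded linear relations *)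

Section Extension.
Variables (R : realType).

Lemma invS_small (e : R) : 0 < e -> exists n, forall i, (n <= i)%N -> i.+1%:R^-1 < e.
Proof.
move=> e0; have [n _ h] := near_infty_natSinv_lt (PosNum e0).
by exists n => i /h.
Qed.

Definition rel_linear (V W : lmodType R[i]) (G : V -> W -> Prop) :=
  forall (z : R[i]) v w v' w', G v w -> G v' w' -> G (z *: v + v') (z *: w + w').

Definition rel_bounded (K : R) (V W : normedModType R[i]) (G : V -> W -> Prop) :=
  forall v w, G v w -> rnorm w <= K * rnorm v.

Definition rel_dense (V W : normedModType R[i]) (G : V -> W -> Prop) :=
  forall v (e : R), 0 < e -> exists v' w, G v' w /\ rnorm (v - v') < e.

Definition rel_closure (V W : normedModType R[i]) (G : V -> W -> Prop) (v : V) (w : W) :=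
  exists (s : nat -> V) (t : nat -> W),
    [/\ forall n, G (s n) (t n), s @ \oo --> v & t @ \oo --> w].

Lemma rel_linearB (V W : lmodType R[i]) (G : V -> W -> Prop) v w v' w' :
  rel_linear G -> G v w -> G v' w' -> G (v - v') (w - w').
Proof.
move=> lin h h'; have := lin (-1) _ _ _ _ h' h.
by rewrite !scaleN1r ![- _ + _]addrC.
Qed.

Lemma rel_functional (K : R) (V W : normedModType R[i]) (G : V -> W -> Prop) v w w' :
  rel_linear G -> rel_bounded K G -> G v w -> G v w' -> w = w'.
Proof.
move=> lin bd h h'; have /bd := rel_linearB lin h h'.
by rewrite subrr rnorm0 mulr0 => /rnorm_le0/eqP; rewrite subr_eq0 => /eqP.
Qed.

Section Closure.
Variables (V W : normedModType R[i]) (G : V -> W -> Prop) (K : R).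

Lemma rel_closure_flip v w :
  rel_closure G v w -> rel_closure (fun w v => G v w) w v.
Proof. by move=> [s [t [? ? ?]]]; exists t, s. Qed.

Lemma rel_closure_sub v w : G v w -> rel_closure G v w.
Proof. by exists (fun=> v), (fun=> w); split=> //; exact: cvg_cst. Qed.

Lemma rel_closure_linear : rel_linear G -> rel_linear (rel_closure G).
Proof.
move=> lin z v w v' w' [s [t [G1 sv tw]]] [s' [t' [G2 sv' tw']]].
exists (fun n => z *: s n + s' n), (fun n => z *: t n + t' n); split.
- by move=> n; exact: lin.
- by apply: cvgD => //; exact: cvgZr.
- by apply: cvgD => //; exact: cvgZr.
Qed.

Lemma rel_closure_bounded : 0 <= K -> rel_bounded K G -> rel_bounded K (rel_closure G).
Proof.
move=> K0 bd v w [s [t [Gst /cvg_rnorm_mapP sv tw]]].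
apply/ler_addgt0Pr => e e0; apply: (cvg_rnorm_le tw).
have K1 : 0 < K + 1 by rewrite ltr_pwDr.
apply: filterS (sv _ (divr_gt0 e0 K1)) => n; rewrite ltr_pdivlMr// => vn.
apply: (le_trans (bd _ _ (Gst n))).
have : rnorm (s n) <= rnorm v + rnorm (v - s n).
  by have := le_rnormB (s n) v; rewrite rnormBC; lra.
by move=> /(ler_wpM2l K0); have := rnorm_ge0 (v - s n); lra.
Qed.

End Closure.

Lemma rel_closure_total (V : normedModType R[i]) (W : completeNormedModType R[i])
    (G : V -> W -> Prop) (K : R) :
  0 <= K -> rel_linear G -> rel_bounded K G -> rel_dense G -> forall v, exists w, rel_closure G v w.
Proof.
move=> K0 lin bd dn v.
have /choice[p hp] : forall n : nat, exists p : V * W, G p.1 p.2 /\ rnorm (v - p.1) < n.+1%:R^-1.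
  move=> n; have [|v' [w [h1 h2]]] := dn v (n.+1%:R^-1); first by rewrite invr_gt0.
  by exists (v', w).
have pv : (fun n => (p n).1) @ \oo --> v.
  apply/cvg_rnorm_mapP => e /invS_small[n hn]; exists n => // i /= /hn.
  by apply: lt_trans; have [] := hp i.
have [w pw] : exists w : W, (fun n => (p n).2) @ \oo --> w.
  apply: cauchy_seq_rnorm => e e0.
  (* Two first components are each within [e / (2 * (K + 1))] of [v], so the images differ by less
     than [e]; [K + 1] keeps the divisor positive when [K = 0]. *)
  have K1 : 0 < 2 * (K + 1) by rewrite mulr_gt0// ltr_pwDr.
  have [n hn] := invS_small (divr_gt0 e0 K1); exists n => i j ni nj.
  have /bd h := rel_linearB lin (hp i).1 (hp j).1; apply: (le_lt_trans h).
  have h1 := lt_trans (hp i).2 (hn i ni); have h2 := lt_trans (hp j).2 (hn j nj).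
  have : rnorm ((p i).1 - (p j).1) <= 2 * (e / (2 * (K + 1))).
    by have := rnorm_dist (p i).1 v (p j).1; rewrite (rnormBC (p i).1 v); lra.
  move: (e / _) (divr_gt0 e0 K1) (divfK (lt0r_neq0 K1) e) => c c0 ce.
  by move=> /(ler_wpM2l K0); lra.
exists w; exists (fun n => (p n).1), (fun n => (p n).2); split => // n.
by have [] := hp n.
Qed.

(** The hypotheses on the converse relation produce the inverse map. Describing the graph as the
    closure of [G] lets identities for [f] be verified on approximating sequences in [G]. *)
Lemma rel_extension (V W : completeNormedModType R[i]) (G : V -> W -> Prop) (K : R) :
  0 <= K -> rel_linear G -> rel_bounded K G -> rel_bounded K (fun w v => G v w) ->
  rel_dense G -> rel_dense (fun w v => G v w) ->
  exists f : {linear V -> W}, bijective f /\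
    forall v w, f v = w <-> rel_closure G v w.
Proof.
move=> K0 lin bd bd' dn dn'.
have lin' : rel_linear (fun w v => G v w) by move=> z v w v' w' h h'; exact: lin.
have /choice[f fP] := rel_closure_total K0 lin bd dn.
have /choice[g gP] := rel_closure_total K0 lin' bd' dn'.
have fun1 v w w' : rel_closure G v w -> rel_closure G v w' -> w = w'.
  apply: rel_functional; first exact: rel_closure_linear.
  exact: rel_closure_bounded bd.
have fun2 v v' w : rel_closure G v w -> rel_closure G v' w -> v = v'.
  move=> /rel_closure_flip h /rel_closure_flip h'.
  apply: rel_functional h h'; first exact: rel_closure_linear.
  exact: rel_closure_bounded bd'.
have flin : linear f.
  by move=> z v v'; apply: fun1 (fP _) _; apply: rel_closure_linear.
pose fL : {linear V -> W} := HB.pack f (GRing.isLinear.Build R[i] V W *:%R f flin).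
exists fL; split=> [|v w].
- exists g => [v|w].
    apply: fun2 (fP v); exact: (rel_closure_flip (gP _)).
  apply: fun1 (fP _) _; exact: (rel_closure_flip (gP _)).
- by split=> [<-|]; [exact: fP|exact: fun1 (fP v)].
Qed.

End Extension.

(** * Tunnels *)

Section Extent.
Variables (R : realType) (F : R -> R -> R -> R -> R).
Implicit Types (A B D : qcms F).

(** The half of the Hausdorff bound that lets an element of [D] be measured by states of [A]. *)
Definition state_close A D (pi : star_morphism D A) (chi : R) :=
  forall phi, state_space D phi -> exists2 psi, state_space A psi &
    (mk (@Lip _ _ D) phi (fun d => psi (pi d)) < chi%:E)%E.

Lemma Hausdorff_state_close A D (pi : star_morphism D A) (chi : R) :
  (Hausdorff_distance (mk (@Lip _ _ D)) (state_space D)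
     [set (fun d => phi (pi d)) | phi in state_space A] < chi%:E)%E ->
  state_close pi chi.
Proof.
rewrite /Hausdorff_distance gt_max => /andP[h _] phi sphi.
have : (ereal_inf [set mk (@Lip _ _ D) phi y |
    y in [set (fun d => psi (pi d)) | psi in state_space A]] < chi%:E)%E.
  by apply: le_lt_trans h; apply: ereal_sup_ubound; exists phi.
by move=> /ereal_inf_lt[_ [_ [psi spsi <-] <-] close]; exists psi.
Qed.

Lemma extent_state_close A B (tau : basic_tunnel A B) (chi : R) :
  (basic_extent tau < chi%:E)%E ->
  state_close (bt_left tau) chi /\ state_close (bt_right tau) chi.
Proof.
by rewrite /basic_extent gt_max => /andP[h1 h2]; split; exact: Hausdorff_state_close.
Qed.

Lemma state_close_rnorm A D (pi : star_morphism D A) (chi l : R) (d : D) :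
  state_close pi chi -> 0 < l -> (Lip d <= l%:E)%E -> rnorm d <= rnorm (pi d) + l * chi.
Proof.
move=> h l0 dl; have sad := L_sa (qcmsP D) dl.
have [phi sphi dphi] := exists_norming_state sad; apply: (le_trans dphi).
have [psi spsi close] := h phi sphi.
have := mk_dist_lt (qcmsP D) sphi (state_pullback pi spsi) l0 dl close.
have := state_sa_le spsi (smap_sa pi sad).
have := le_rnormB (phi d) (psi (pi d)); lra.
Qed.

Lemma state_close_rnormC A D (pi : star_morphism D A) (chi l : R) (d : D) :
  state_close pi chi -> 0 < l -> clipschitz (@Lip _ _ D) l d ->
  rnorm d <= 2 * rnorm (pi d) + 2 * (l * chi).
Proof.
move=> h l0 [d1 d2]; have := state_close_rnorm h l0 d1; have := state_close_rnorm h l0 d2.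
rewrite smap_Re smap_Im.
have := rnorm_Re_part (pi d); have := rnorm_Im_part (pi d).
have := rnormD (Re_part d) ('i *: Im_part d).
rewrite -Re_Im_part (rnormZ 'i) rnorm_i mul1r; lra.
Qed.

Lemma quantum_isometry_le A D (pi : star_morphism D A) (d : D) (l : R) :
  quantum_isometry pi -> (Lip d <= l%:E)%E -> (Lip (pi d) <= l%:E)%E.
Proof.
move=> [_ h] dl; have sad := L_sa (qcmsP D) dl.
rewrite h; last exact: smap_sa.
by apply: le_trans dl; apply: ereal_inf_lbound; exists d.
Qed.

(** The strict inequality on [a] leaves room for the infimum that defines the quotient seminorm. *)
Lemma quantum_isometry_lift A D (pi : star_morphism D A) (a : A) (l : R) :
  quantum_isometry pi -> (Lip a < l%:E)%E -> exists2 d : D, pi d = a & (Lip d <= l%:E)%E.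
Proof.
move=> [_ h] al; have saa := L_sa (qcmsP A) (ltW al).
move: al; rewrite h// => /ereal_inf_lt[_ [d [_ <-] <-] dl].
by exists d => //; exact: ltW.
Qed.

Lemma Hausdorff_state_ge0 A D (pi : star_morphism D A) :
  (0 <= Hausdorff_distance (mk (@Lip _ _ D)) (state_space D)
     [set (fun d => phi (pi d)) | phi in state_space A])%E.
Proof.
have [phi sphi] := state_space_nonempty D.
rewrite /Hausdorff_distance le_max; apply/orP; left.
apply: (@le_trans _ _ (ereal_inf [set mk (@Lip _ _ D) phi y |
    y in [set (fun d => psi (pi d)) | psi in state_space A]])).
  by apply: le_ereal_inf_tmp => _ [y _ <-]; exact: (mk_ge0 (qcmsP D)).
by apply: ereal_sup_ubound; exists phi.
Qed.

Lemma Hausdorff_state_fin A D (pi : star_morphism D A) :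
  (Hausdorff_distance (mk (@Lip _ _ D)) (state_space D)
     [set (fun d => phi (pi d)) | phi in state_space A] < +oo)%E.
Proof.
have [M M0 hM] := mk_bounded (qcmsP D).
have [phi sphi] := state_space_nonempty D; have [psi spsi] := state_space_nonempty A.
apply: (@le_lt_trans _ _ M%:E); last exact: ltry.
rewrite /Hausdorff_distance ge_max; apply/andP; split; apply: ge_ereal_sup => _ [x hx <-].
- apply: (@le_trans _ _ (mk (@Lip _ _ D) x (fun d => psi (pi d)))).
    by apply: ereal_inf_lbound; exists (fun d => psi (pi d)) => //; exists psi.
  by apply: hM => //; exact: state_pullback.
- apply: (@le_trans _ _ (mk (@Lip _ _ D) phi x)).
    by apply: ereal_inf_lbound; exists phi.
  by apply: hM => //; case: hx => xi sxi <-; exact: state_pullback.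
Qed.

Lemma basic_extent_ge0 A B (tau : basic_tunnel A B) : (0 <= basic_extent tau)%E.
Proof. by rewrite /basic_extent le_max Hausdorff_state_ge0. Qed.

Lemma basic_extent_fin A B (tau : basic_tunnel A B) : (basic_extent tau < +oo)%E.
Proof. by rewrite /basic_extent gt_max !Hausdorff_state_fin. Qed.

Lemma Hausdorff_state_bij A D (pi : star_morphism D A) : bijective pi ->
  (Hausdorff_distance (mk (@Lip _ _ D)) (state_space D)
     [set (fun d => phi (pi d)) | phi in state_space A] <= 0)%E.
Proof.
move=> bpi; rewrite state_pullback_bij// /Hausdorff_distance ge_max.
by apply/andP; split; apply: ge_ereal_sup => _ [x hx <-];
  rewrite -(mk_refl (qcmsP D) x); apply: ereal_inf_lbound; exists x.
Qed.

End Extent.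

(** * Limits of tunnels whose extents tend to 0 *)

Section TunnelSequences.
Variables (R : realType) (F : R -> R -> R -> R -> R) (H : R -> R -> R).
Hypothesis hFH : permissible_pair F H.

Section Relation.
Variables (A B : mqvb F H) (tau : nat -> modular_tunnel A B).

Let D n := mt_bundle (tau n).
Let pi n : star_morphism (base (D n)) (base A) := hbase (mt_left (tau n)).
Let rho n : star_morphism (base (D n)) (base B) := hbase (mt_right (tau n)).
Let Pi n : {linear bmod (D n) -> bmod A} := hmod (mt_left (tau n)).
Let Rho n : {linear bmod (D n) -> bmod B} := hmod (mt_right (tau n)).

(* Limits along an ultrafilter replace the diagonal extraction of convergent
   subsequences of lifts. *)
Variable U : set_system nat.

(** Bounding real and imaginary parts through [clipschitz], instead of taking self-adjoint lifts,
    makes the relation complex linear and multiplicative. *)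
Definition base_rel (a : base A) (b : base B) : Prop :=
  exists (l : R) (d : forall n, base (D n)),
    [/\ \forall n \near U, clipschitz (@Lip _ _ (base (D n))) l (d n),
        (fun n => pi n (d n)) @ U --> a & (fun n => rho n (d n)) @ U --> b].

Definition mod_rel (w : bmod A) (v : bmod B) : Prop :=
  exists (l : R) (x : forall n, bmod (D n)),
    [/\ \forall n \near U, (Dn (x n) <= l%:E)%E,
        (fun n => Pi n (x n)) @ U --> w & (fun n => Rho n (x n)) @ U --> v].

Hypothesis UU : UltraFilter U.
Hypothesis Uoo : \oo `<=` U.
Hypothesis tau_small : forall n, (extent (tau n) < (n.+1%:R^-1)%:E)%E.

Let UF : ProperFilter U. Proof. exact: ultra_proper. Qed.

Lemma base_rel_linear : rel_linear base_rel.
Proof.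
move=> z a b a' b' [l [d [dl da db]]] [l' [d' [dl' da' db']]].
exists (`|complex.Re z| * l + `|complex.Im z| * l + l'), (fun n => z *: d n + d' n).
split.
- apply: filterS (filterI dl dl') => n [h h'].
  by apply: (clipschitzD (qcmsP _)) h'; exact: (clipschitzZ (qcmsP _)).
- rewrite (_ : (fun n => _) = fun n => z *: pi n (d n) + pi n (d' n)).
    by apply: cvgD => //; exact: cvgZr.
  by apply/funext => n; rewrite linearP.
- rewrite (_ : (fun n => _) = fun n => z *: rho n (d n) + rho n (d' n)).
    by apply: cvgD => //; exact: cvgZr.
  by apply/funext => n; rewrite linearP.
Qed.

(** At a fixed Lipschitz bound [l] the error, proportional to the extent, vanishes along [U]
    uniformly in [d]. Passing to [|l| + 1] makes the bound positive. *)
Lemma tunnel_rnorm (e l : R) : 0 < e -> \forall n \near U, forall d : base (D n),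
  clipschitz (@Lip _ _ (base (D n))) l d -> rnorm d <= 2 * rnorm (pi n d) + e.
Proof.
move=> e0; have l1 : 0 < 2 * (`|l| + 1) by rewrite mulr_gt0// ltr_pwDr.
have [n hn] := invS_small (divr_gt0 e0 l1).
apply: Uoo; exists n => // i /= /hn ni d [d1 d2].
have ll : l <= `|l| + 1 by have := ler_norm l; lra.
have d' : clipschitz (@Lip _ _ (base (D i))) (`|l| + 1) d.
  by split; [apply: le_trans d1 _|apply: le_trans d2 _]; rewrite lee_fin.
have [close _] := extent_state_close (tau_small i).
have := state_close_rnormC close (_ : 0 < `|l| + 1) d'.
rewrite ltr_pwDr// => /(_ isT) h; apply: (le_trans h); rewrite lerD2l mulrA mulrC.
by rewrite -ler_pdivlMr// ltW.
Qed.

Lemma base_rel_bounded : rel_bounded 2 base_rel.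
Proof.
move=> a b [l [d [dl /cvg_rnorm_mapP da db]]].
apply/ler_addgt0Pr => e e0; apply: (cvg_rnorm_le db).
have e4 : 0 < e / 4 by rewrite divr_gt0.
apply: filterS (filterI dl (filterI (da _ e4) (tunnel_rnorm l e4))) => n [h [da' /(_ _ h) dn]].
have := smap_rnorm (rho n) (d n); have := le_rnormB (pi n (d n)) a.
rewrite rnormBC; lra.
Qed.

Lemma base_rel_cunit : base_rel cunit cunit.
Proof.
exists 0, (fun=> cunit); split.
- by apply: nearW => n; exact: (clipschitz_cunit (qcmsP _)).
- by rewrite (_ : (fun n => _) = fun=> cunit); [exact: cvg_cst|apply/funext => n; rewrite smap1].
- by rewrite (_ : (fun n => _) = fun=> cunit); [exact: cvg_cst|apply/funext => n; rewrite smap1].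
Qed.

Lemma base_rel_star a b : base_rel a b -> base_rel (star a) (star b).
Proof.
move=> [l [d [dl da db]]]; exists l, (fun n => star (d n)); split.
- by apply: filterS dl => n; exact: (clipschitz_star (qcmsP _)).
- rewrite (_ : (fun n => _) = fun n => star (pi n (d n))); first exact: star_cvg.
  by apply/funext => n; rewrite smap_star.
- rewrite (_ : (fun n => _) = fun n => star (rho n (d n))); first exact: star_cvg.
  by apply/funext => n; rewrite smap_star.
Qed.

Lemma base_rel_mul a b a' b' : base_rel a b -> base_rel a' b' -> base_rel (a ** a') (b ** b').
Proof.
move=> [l [d [dl da db]]] [l' [d' [dl' da' db']]].
(* Along [U] the images in [A] exceed the norms of their limits by at most 1, so [tunnel_rnorm] with
   error 1 bounds [d n] and [d' n] by [K]. *)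
pose m := Num.max l l'; pose K := 2 * (Num.max (rnorm a) (rnorm a') + 1) + 1.
have [pF _ _] := hFH.
exists (F K K m m + F K K m m + (F K K m m + F K K m m)), (fun n => d n ** d' n); split.
- have /cvg_rnorm_mapP/(_ _ ltr01) ha := da; have /cvg_rnorm_mapP/(_ _ ltr01) ha' := da'.
  have hn := tunnel_rnorm l ltr01; have hn' := tunnel_rnorm l' ltr01.
  apply: filterS (filterI (filterI dl dl') (filterI (filterI ha ha') (filterI hn hn'))) => n.
  move=> [[h h'] [[na na'] [/(_ _ h) nd /(_ _ h') nd']]].
  have wk x k : k <= m -> clipschitz (@Lip _ _ (base (D n))) k x ->
      clipschitz (@Lip _ _ (base (D n))) m x.
    by move=> km [h1 h2]; split; [apply: le_trans h1 _|apply: le_trans h2 _]; rewrite lee_fin.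
  have ma : rnorm a <= Num.max (rnorm a) (rnorm a') by rewrite le_max lexx.
  have ma' : rnorm a' <= Num.max (rnorm a) (rnorm a') by rewrite le_max lexx orbT.
  apply: (clipschitz_cmul (qcmsP _) pF).
  + by apply: wk h; rewrite le_max lexx.
  + by apply: wk h'; rewrite le_max lexx orbT.
  + have := le_rnormB (pi n (d n)) a; rewrite rnormBC /K; lra.
  + have := le_rnormB (pi n (d' n)) a'; rewrite rnormBC /K; lra.
- rewrite (_ : (fun n => _) = fun n => pi n (d n) ** pi n (d' n)); first exact: cmul_cvg.
  by apply/funext => n; rewrite smapM.
- rewrite (_ : (fun n => _) = fun n => rho n (d n) ** rho n (d' n)); first exact: cmul_cvg.
  by apply/funext => n; rewrite smapM.
Qed.

(** Lift the same [a] to every tunnel. The images in [B] have seminorm at most [l] and bounded norm,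
    so they converge along [U] to an element of seminorm at most [l]. *)
Lemma base_rel_lift (a : base A) (l : R) : (Lip a < l%:E)%E ->
  exists2 b : base B, base_rel a b & (Lip b <= l%:E)%E.
Proof.
move=> al; have pq n : quantum_isometry (pi n).
  exact: modular_quantum_isometry_base (mt_leftP (tau n)).
have rq n : quantum_isometry (rho n).
  exact: modular_quantum_isometry_base (mt_rightP (tau n)).
pose d n := s2val (cid2 (quantum_isometry_lift (pq n) al)).
have da n : pi n (d n) = a by rewrite /d; case: cid2.
have dl n : (Lip (d n) <= l%:E)%E by rewrite /d; case: cid2.
have dl' n : clipschitz (@Lip _ _ (base (D n))) l (d n) by exact: (clipschitz_sa (qcmsP _)).
have [|b rb bl] := @Lip_ball_cvg _ _ _ _ (qcmsP (base B)) _ U (fun n => rho n (d n)) l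
  (2 * rnorm a + 1) UU.
- apply: filterS (tunnel_rnorm l ltr01) => n /(_ _ (dl' n)); rewrite da => h; split.
    exact: quantum_isometry_le.
  by apply: le_trans h; exact: smap_rnorm.
exists b => //; exists l, d; split => //; first exact: nearW.
by rewrite (_ : (fun n => _) = fun=> a); [exact: cvg_cst|apply/funext => n; rewrite da].
Qed.

(** Lifting gives the bound [Lip a + e] for some element related to [a]. Since [a] has only one such
    element, it is [b] for every [e]. *)
Lemma base_rel_Lip a b : base_rel a b -> (Lip b <= Lip a)%E.
Proof.
move=> ab; have [aoo|] := boolP (Lip a == +oo)%E; first by rewrite (eqP aoo) leey.
rewrite -ltey => afin; have aE : Lip a = (fine (Lip a))%:E.
  by rewrite fineK// ge0_fin_numE// (L_ge0 (qcmsP _)).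
apply/lee_addgt0Pr => e e0; rewrite aE -EFinD.
have [|b' ab' b'l] := @base_rel_lift a (fine (Lip a) + e).
  by rewrite [X in (X < _)%E]aE lte_fin ltrDl.
by rewrite (rel_functional base_rel_linear base_rel_bounded ab ab').
Qed.

Lemma base_rel_total (a : base A) : (Lip a < +oo)%E ->
  exists2 b : base B, base_rel a b & (Lip b <= Lip a)%E.
Proof.
move=> afin; have [|b ab _] := @base_rel_lift a (fine (Lip a) + 1).
  rewrite -[X in (X < _)%E]fineK; first by rewrite lte_fin ltrDl.
  by rewrite ge0_fin_numE// (L_ge0 (qcmsP _)).
by exists b => //; exact: base_rel_Lip.
Qed.

Lemma base_rel_dense : rel_dense base_rel.
Proof.
move=> a e e0; have e20 : 0 < e / 2 by rewrite divr_gt0.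
have h c : sa c -> exists x y, base_rel x y /\ rnorm (c - x) < e / 2.
  move=> /(L_dense (qcmsP _))/closure_rnormP/(_ _ e20)[x xoo cx].
  by have [y xy _] := base_rel_total xoo; exists x, y.
have [x [y [xy cx]]] := h _ (sa_Re a); have [x' [y' [xy' cx']]] := h _ (sa_Im a).
exists ('i *: x' + x), ('i *: y' + y); split; first exact: base_rel_linear.
rewrite {1}(Re_Im_part a) [_ + x]addrC opprD addrACA -scalerBr.
apply: (le_lt_trans (rnormD _ _)); rewrite (rnormZ 'i) rnorm_i mul1r; lra.
Qed.

Lemma mod_rel_linear : rel_linear mod_rel.
Proof.
move=> z w v w' v' [l [x [xl xw xv]]] [l' [x' [xl' xw' xv']]].
exists (rnorm z * l + l'), (fun n => z *: x n + x' n).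
split.
- apply: filterS (filterI xl xl') => n [h h'].
  have dz : (Dn (z *: x n) <= (rnorm z * l)%:E)%E.
    rewrite (D_Z (mqvbP (D n))) ?EFinM ?lee_wpmul2l// ?lee_fin ?rnorm_ge0//.
    exact: le_lt_trans h (ltry _).
  apply: le_trans (D_D (mqvbP (D n)) _ _) _.
  + exact: le_lt_trans dz (ltry _).
  + exact: le_lt_trans h' (ltry _).
  + by rewrite EFinD leeD.
- rewrite (_ : (fun n => _) = fun n => z *: Pi n (x n) + Pi n (x' n)).
    by apply: cvgD => //; exact: cvgZr.
  by apply/funext => n; rewrite linearP.
- rewrite (_ : (fun n => _) = fun n => z *: Rho n (x n) + Rho n (x' n)).
    by apply: cvgD => //; exact: cvgZr.
  by apply/funext => n; rewrite linearP.
Qed.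

(** The bridge from modules to algebras: [H] turns D-norm bounds on the lifts into a Lipschitz bound
    on their inner products. *)
Lemma mod_rel_inner w v w' v' : mod_rel w v -> mod_rel w' v' ->
  base_rel (inner w w') (inner v v').
Proof.
move=> [l [x [xl xw xv]]] [l' [x' [xl' xw' xv']]].
have [_ Hmono _] := hFH.
exists (H l l'), (fun n => inner (x n) (x' n)); split.
- apply: filterS (filterI xl xl') => n [h h'].
  have bd y k : (Dn (y : bmod (D n)) <= k%:E)%E -> 0 <= fine (Dn y) <= k.
    move=> yk; have y0 := D_ge0 (mqvbP (D n)) y; rewrite fine_ge0//=.
    by rewrite -lee_fin fineK// ge0_fin_numE// (le_lt_trans yk (ltry _)).
  have := D_inner (mqvbP (D n)) (le_lt_trans h (ltry _)) (le_lt_trans h' (ltry _)).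
  have := Hmono _ _ _ _ (bd _ _ h) (bd _ _ h').
  rewrite -lee_fin => le2 le1; have := le_trans le1 le2.
  by rewrite ge_max => /andP[].
- rewrite (_ : (fun n => _) = fun n => inner (Pi n (x n)) (Pi n (x' n))); first exact: inner_cvg.
  by apply/funext => n; rewrite /pi hmod_inner.
- rewrite (_ : (fun n => _) = fun n => inner (Rho n (x n)) (Rho n (x' n))); first exact: inner_cvg.
  by apply/funext => n; rewrite /rho hmod_inner.
Qed.

(** Through [inner w w] the squared norms inherit the constant 2 of the base relation, and 2 is at
    most [2 ^+ 2]. *)
Lemma mod_rel_bounded : rel_bounded 2 mod_rel.
Proof.
move=> w v wv; have := base_rel_bounded (mod_rel_inner wv wv).
rewrite !rnorm_inner_sqr => h.
rewrite -(@ler_pXn2r _ 2) ?nnegrE ?mulr_ge0 ?rnorm_ge0// exprMn.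
by apply: (le_trans h); rewrite ler_wpM2r ?sqr_ge0// expr2; lra.
Qed.

Lemma mod_rel_lift (w : bmod A) (l : R) : (Dn w < l%:E)%E ->
  exists2 v : bmod B, mod_rel w v & (Dn v <= l%:E)%E.
Proof.
move=> wl; have l0 : 0 < l by rewrite -lte_fin; apply: le_lt_trans wl; exact: (D_ge0 (mqvbP A)).
have lift n : exists2 x : bmod (D n), Pi n x = w & (Dn x <= l%:E)%E.
  have [_ _ h] := mt_leftP (tau n); move: wl; rewrite h => /ereal_inf_lt[_ [x xw <-] xl].
  by exists x => //; exact: ltW.
pose x n := s2val (cid2 (lift n)).
have xw n : Pi n (x n) = w by rewrite /x; case: cid2.
have xl n : (Dn (x n) <= l%:E)%E by rewrite /x; case: cid2.
have rl n : (Dn (Rho n (x n)) <= l%:E)%E.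
  have [_ _ h] := mt_rightP (tau n); rewrite h; apply: le_trans (xl n).
  by apply: ereal_inf_lbound; exists (x n).
(* Compactness is stated for the unit ball of the D-norm, so the images are rescaled by [l^-1] and
   the limit is scaled back. *)
have := D_compact (mqvbP B); rewrite compact_ultra.
have lV0 : `|l^-1| = l^-1 by rewrite ger0_norm// invr_ge0 ltW.
move=> /(_ ((fun n => l^-1%:C *: Rho n (x n)) @ U) (ultra_fmap _ UU)) [].
  apply: nearW => n /=; rewrite (D_Z (mqvbP B)); last exact: le_lt_trans (rl n) (ltry _).
  rewrite rnormC lV0; apply: (@le_trans _ _ (l^-1%:E * l%:E)%E).
    by rewrite lee_wpmul2l// lee_fin invr_ge0 ltW.
  by rewrite -EFinM mulVf// gt_eqF.
move=> v [/= v1 xv]; exists (l%:C *: v).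
  exists l, x; split; first exact: nearW.
    by rewrite (_ : (fun n => _) = fun=> w); [exact: cvg_cst|apply/funext => n; rewrite xw].
  rewrite (_ : (fun n => _) = fun n => l%:C *: (l^-1%:C *: Rho n (x n))); first exact: cvgZr.
  apply/funext => n; rewrite scalerA -rmorphM mulfV ?gt_eqF// rmorph1 scale1r//.
rewrite (D_Z (mqvbP B)); last exact: le_lt_trans v1 (ltry _).
rewrite rnormC (ger0_norm (ltW l0)); apply: (@le_trans _ _ (l%:E * 1)%E).
  by rewrite lee_wpmul2l// lee_fin ltW.
by rewrite mule1.
Qed.

Lemma mod_rel_Dn w v : mod_rel w v -> (Dn v <= Dn w)%E.
Proof.
move=> wv; have [woo|] := boolP (Dn w == +oo)%E; first by rewrite (eqP woo) leey.
rewrite -ltey => wfin; have wE : Dn w = (fine (Dn w))%:E.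
  by rewrite fineK// ge0_fin_numE// (D_ge0 (mqvbP A)).
apply/lee_addgt0Pr => e e0; rewrite wE -EFinD.
have [|v' wv' v'l] := @mod_rel_lift w (fine (Dn w) + e).
  by rewrite [X in (X < _)%E]wE lte_fin ltrDl.
by rewrite (rel_functional mod_rel_linear mod_rel_bounded wv wv').
Qed.

Lemma mod_rel_total (w : bmod A) : (Dn w < +oo)%E ->
  exists2 v : bmod B, mod_rel w v & (Dn v <= Dn w)%E.
Proof.
move=> wfin; have [|v wv _] := @mod_rel_lift w (fine (Dn w) + 1).
  rewrite -[X in (X < _)%E]fineK; first by rewrite lte_fin ltrDl.
  by rewrite ge0_fin_numE// (D_ge0 (mqvbP A)).
by exists v => //; exact: mod_rel_Dn.
Qed.

Lemma mod_rel_dense : rel_dense mod_rel.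
Proof.
move=> w e e0; have [x xoo wx] := @dense_rnorm _ _ _ w e (D_dense (mqvbP A)) e0.
by have [v xv _] := mod_rel_total xoo; exists x, v.
Qed.

End Relation.

Lemma extent_inverse (A B : mqvb F H) (tau : modular_tunnel A B) :
  extent (inverse_tunnel tau) = extent tau.
Proof. by rewrite /extent /basic_extent maxC. Qed.

Section FullIsometry.
Variables (A B : mqvb F H) (tau : nat -> modular_tunnel A B).
Hypothesis tau_small : forall n, (extent (tau n) < (n.+1%:R^-1)%:E)%E.
Variable U : set_system nat.
Hypotheses (UU : UltraFilter U) (Uoo : \oo `<=` U).

Let tau' n := inverse_tunnel (tau n).

Let tau'_small n : (extent (tau' n) < (n.+1%:R^-1)%:E)%E.
Proof. by rewrite extent_inverse. Qed.

Let G := base_rel tau U.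
Let GM := mod_rel tau U.

Let G' b a : base_rel tau' U b a <-> G a b.
Proof. by split=> -[l [d [? ? ?]]]; exists l, d. Qed.

Let GM' v w : mod_rel tau' U v w <-> GM w v.
Proof. by split=> -[l [d [? ? ?]]]; exists l, d. Qed.

Lemma base_extension : exists f : star_morphism (base A) (base B),
  [/\ bijective f, forall a b, f a = b <-> rel_closure G a b & forall a, Lip (f a) = Lip a].
Proof.
have lin : rel_linear G by exact: base_rel_linear.
have bd : rel_bounded 2 G by exact: base_rel_bounded.
have bd' : rel_bounded 2 (fun b a => G a b).
  by move=> b a /G'; exact: base_rel_bounded.
have dn : rel_dense G by exact: base_rel_dense.
have dn' : rel_dense (fun b a => G a b).
  move=> b e e0; have [b' [a [/G' h bb']]] := base_rel_dense UU Uoo tau'_small b e0.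
  by exists b', a.
have [f [fbij fE]] := rel_extension (ler0n _ 2) lin bd bd' dn dn'.
have f1 : f cunit = cunit by apply/fE/rel_closure_sub; exact: base_rel_cunit.
have fM a b : f (a ** b) = f a ** f b.
  have [s [t [Gst sa ta]]] := (fE a (f a)).1 erefl.
  have [s' [t' [Gst' sb tb]]] := (fE b (f b)).1 erefl.
  apply/fE; exists (fun n => s n ** s' n), (fun n => t n ** t' n); split.
  - by move=> n; exact: (base_rel_mul UU Uoo tau_small (Gst n) (Gst' n)).
  - exact: cmul_cvg.
  - exact: cmul_cvg.
have fS a : f (star a) = star (f a).
  have [s [t [Gst sa ta]]] := (fE a (f a)).1 erefl.
  apply/fE; exists (fun n => star (s n)), (fun n => star (t n)); split.
  - by move=> n; exact: (base_rel_star UU (Gst n)).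
  - exact: star_cvg.
  - exact: star_cvg.
exists (StarMorphism f1 fM fS); split=> // a /=.
have finj := bij_inj fbij.
(* An element of finite seminorm is related to its image by [G] itself, so the bound of
   [base_rel_total] is exact. The reverse inequality uses the inverse tunnels and injectivity of
   [f]. *)
apply/eqP; rewrite eq_le; apply/andP; split.
- have [aoo|] := boolP (Lip a == +oo)%E; first by rewrite (eqP aoo) leey.
  rewrite -ltey => /(base_rel_total UU Uoo tau_small)[b ab].
  by have -> : f a = b by apply/fE/rel_closure_sub.
- have [aoo|] := boolP (Lip (f a) == +oo)%E; first by rewrite (eqP aoo) leey.
  rewrite -ltey => /(base_rel_total UU Uoo tau'_small)[c /G' ca].
  by have /finj -> : f c = f a by apply/fE/rel_closure_sub.
Qed.

Lemma mod_extension : exists f : {linear bmod A -> bmod B},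
  [/\ bijective f, forall w v, f w = v <-> rel_closure GM w v & forall w, Dn (f w) = Dn w].
Proof.
have lin : rel_linear GM by exact: mod_rel_linear.
have bd : rel_bounded 2 GM by exact: mod_rel_bounded.
have bd' : rel_bounded 2 (fun v w => GM w v).
  by move=> v w /GM'; exact: mod_rel_bounded.
have dn : rel_dense GM by exact: mod_rel_dense.
have dn' : rel_dense (fun v w => GM w v).
  move=> v e e0; have [v' [w [/GM' h vv']]] := mod_rel_dense UU Uoo tau'_small v e0.
  by exists v', w.
have [f [fbij fE]] := rel_extension (ler0n _ 2) lin bd bd' dn dn'.
exists f; split=> // w; have finj := bij_inj fbij.
apply/eqP; rewrite eq_le; apply/andP; split.
- have [woo|] := boolP (Dn w == +oo)%E; first by rewrite (eqP woo) leey.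
  rewrite -ltey => /(mod_rel_total UU Uoo tau_small)[v wv].
  by have -> : f w = v by apply/fE/rel_closure_sub.
- have [woo|] := boolP (Dn (f w) == +oo)%E; first by rewrite (eqP woo) leey.
  rewrite -ltey => /(mod_rel_total UU Uoo tau'_small)[x /GM' xw].
  by have /finj -> : f x = f w by apply/fE/rel_closure_sub.
Qed.

Lemma full_isometry_of_small_tunnels :
  exists f : hilbert_morphism A B, full_modular_quantum_isometry f.
Proof.
have [f [fbij fE fL]] := base_extension; have [g [gbij gE gD]] := mod_extension.
have fg w v : f (inner w v) = inner (g w) (g v).
  have [s [t [Gst sw tw]]] := (gE w (g w)).1 erefl.
  have [s' [t' [Gst' sv tv]]] := (gE v (g v)).1 erefl.
  apply/fE; exists (fun n => inner (s n) (s' n)), (fun n => inner (t n) (t' n)); split.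
  - by move=> n; exact: (mod_rel_inner UU (Gst n) (Gst' n)).
  - exact: inner_cvg.
  - exact: inner_cvg.
have gact a w : g (act a w) = act (f a) (g w).
  (* The difference is shown orthogonal to itself: writing its second copy as a value of [g], both
     terms are carried back to [A] by [fg], where [inner_act] makes them cancel. *)
  apply/eqP; rewrite -subr_eq0; apply/eqP/inner_eq0.
  have [h hK gK] := gbij.
  rewrite -[X in inner _ X]gK innerBl -fg !inner_act -fg.
  by rewrite smapM subrr.
by exists (HilbertMorphism gact fg).
Qed.

End FullIsometry.

Lemma extent_full_isometry_tunnel (A B : mqvb F H) (f : hilbert_morphism A B)
    (fP : full_modular_quantum_isometry f) : (extent (full_isometry_tunnel fP) <= 0)%E.
Proof.
rewrite /extent /basic_extent ge_max; apply/andP; split; apply: Hausdorff_state_bij.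
  by exists idfun.
by case: fP => -[].
Qed.

End TunnelSequences.

(** * The pseudo-metric axioms, from those of an appropriate class *)

Section Propinquity.
Variables (R : realType) (F : R -> R -> R -> R -> R) (H : R -> R -> R).
Variables (C : mqvb F H -> Prop) (T : tunnel_class F H).
Hypothesis hT : appropriate C T.
Local Notation Lambda := (dual_modular_propinquity T).

Lemma propinquity_ge0 A B : (0 <= Lambda A B)%E.
Proof. by apply: le_ereal_inf_tmp => _ [tau _ <-]; exact: basic_extent_ge0. Qed.

Lemma propinquity_le A B (tau : modular_tunnel A B) : T tau -> (Lambda A B <= extent tau)%E.
Proof. by move=> Ttau; apply: ereal_inf_lbound; exists tau. Qed.

Lemma propinquity_fin A B : C A -> C B -> (Lambda A B < +oo)%E.
Proof.
move=> CA CB; have [tau Ttau] := appr_ex hT CA CB.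
exact: le_lt_trans (propinquity_le Ttau) (basic_extent_fin _).
Qed.

Lemma propinquity_full_isometry A B (f : hilbert_morphism A B) :
  C A -> C B -> full_modular_quantum_isometry f -> Lambda A B = 0%E.
Proof.
move=> CA CB fP; apply/eqP; rewrite eq_le propinquity_ge0 andbT.
apply: le_trans (extent_full_isometry_tunnel fP).
by apply: propinquity_le; exact: (appr_full hT).
Qed.

Lemma propinquity_sym A B : Lambda A B = Lambda B A.
Proof.
have h X Y : (Lambda X Y <= Lambda Y X)%E.
  apply: le_ereal_inf_tmp => _ [tau Ttau <-]; rewrite -extent_inverse.
  exact/propinquity_le/(appr_inv hT).
by apply/eqP; rewrite eq_le !h.
Qed.

Lemma propinquity_triangle A B E : C A -> C B -> C E ->
  (Lambda A E <= Lambda A B + Lambda B E)%E.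
Proof.
move=> CA CB CE; apply/lee_addgt0Pr => e e0.
(* The error [e] is spent in thirds: one for each of two nearly optimal tunnels and one for their
   composition. *)
have near X Y : C X -> C Y -> exists2 tau : modular_tunnel X Y, T tau &
    (extent tau <= Lambda X Y + (e / 3)%:E)%E.
  move=> CX CY; have fin : Lambda X Y \is a fin_num.
    by rewrite ge0_fin_numE ?propinquity_ge0// propinquity_fin.
  have [|_ [tau Ttau <-] h] := @lb_ereal_inf_adherent _ _ (e / 3) _ fin.
    by rewrite divr_gt0.
  by exists tau => //; exact: ltW.
have [t1 T1 h1] := near _ _ CA CB; have [t2 T2 h2] := near _ _ CB CE.
have [|t Tt ht] := appr_comp hT T1 T2 (_ : 0 < e / 3); first by rewrite divr_gt0.
apply: le_trans (propinquity_le Tt) _; apply: le_trans ht _.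
apply: (@le_trans _ _ (Lambda A B + (e / 3)%:E + (Lambda B E + (e / 3)%:E) + (e / 3)%:E)%E).
  by rewrite leeD2r// leeD.
rewrite addeACA -!addeA leeD2l// leeD2l// -!EFinD lee_fin; lra.
Qed.

End Propinquity.


Theorem theorem3p22 (R : realType)
    (F : R -> R -> R -> R -> R) (H : R -> R -> R)
    (hFH : permissible_pair F H)
    (C : mqvb F H -> Prop) (hC : exists A : mqvb F H, C A)
    (T : tunnel_class F H) (hT : appropriate C T) :
  pseudometric_on C (dual_modular_propinquity T) /\
  (forall A B : mqvb F H, C A -> C B ->
     dual_modular_propinquity T A B = 0%E <->
     exists f : hilbert_morphism A B, full_modular_quantum_isometry f).
Proof.
split.
- split=> [A B CA CB|A CA|A B _ _|A B E CA CB CE].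
  + by rewrite propinquity_ge0 (propinquity_fin hT).
  + exact: (propinquity_full_isometry hT CA CA (full_modular_quantum_isometry_id A)).
  + exact: (propinquity_sym hT).
  + exact: (propinquity_triangle hT CA CB CE).
- move=> A B CA CB; split=> [AB0|[f]]; last exact: (propinquity_full_isometry hT).
  have small n : exists tau : modular_tunnel A B, (extent tau < (n.+1%:R^-1)%:E)%E.
    have : (dual_modular_propinquity T A B < (n.+1%:R^-1)%:E)%E.
      by rewrite AB0 lte_fin invr_gt0.
    by move=> /ereal_inf_lt[_ [tau _ <-] h]; exists tau.
  have /choice[tau tau_small] := small.
  have [U [UU Uoo]] := @ultraFilterLemma nat \oo _.
  exact: (full_isometry_of_small_tunnels hFH tau_small UU Uoo).
Qed.
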